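(* Let $P\subset A$ be an inclusion of unital C*-algebras and let $E\colon A\to P$ be a conditional expectation of index finite type which has the tracial Rokhlin property. Suppose that $A$ is simple with real rank zero. Then $P$ has real rank zero.
   Context: A unital C*-algebra has real rank zero if its invertible self-adjoint elements are dense in its self-adjoint elements. For an inclusion $P\subset A$ of unital C*-algebras (with common unit), a conditional expectation $E\colon A\to P$ is of index finite type (index finite) if there is a finite quasi-basis $\{(u_i,v_i)\}_{i=1}^n\subset A\times A$, i.e. $x=\sum_i u_iE(v_ix)=\sum_iE(xu_i)v_i$ for all $x\in A$; then $\mathrm{Index}\,E=\sum_i u_iv_i$. For a C*-algebra $B$, $B^\infty=\ell^\infty(\mathbb{N},B)/c_0(\mathbb{N},B)$, with $B\subset B^\infty$ via constant sequences; $P^\infty\subset A^\infty$, $A'\cap A^\infty$ is the relative commutant of $A$, and $E^\infty\colon A^\infty\to P^\infty$ is the map induced by applying $E$ entrywise. A conditional expectation $E\colon A\to P$ of index finite has the tracial Rokhlin property if for every nonzero positive $z\in A^\infty$ there exists a projection $e\in A'\cap A^\infty$ such that $(\mathrm{Index}\,E)E^\infty(e)=g$ is a projection, $1-g$ is Murray-von Neumann equivalent to a projection in the hereditary subalgebra of $A^\infty$ generated by $z$, and the map $A\ni x\mapsto xe$ is injective. *)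

(* Defs.v *)
From HB Require Import structures.
From mathcomp Require Import all_boot all_order all_algebra.
From mathcomp Require Import generic_quotient ring_quotient complex.
From mathcomp Require Import all_classical all_reals.
From mathcomp Require Import interval_inference topology normedtype sequences.

Set Implicit Arguments.
Unset Strict Implicit.
Unset Printing Implicit Defensive.
Import Order.TTheory GRing.Theory Num.Theory.
Import numFieldNormedType.Exports.

Local Open Scope classical_set_scope.
Local Open Scope ring_scope.
Local Open Scope complex_scope.
Local Open Scope quotient_scope.

(* Unital C*-algebras over R[i].  The norm is a field of the structure, with
   values in R, because [normedModType] and [algType] cannot be joined outside MathComp:
   [numDomainType] inherits from semirings and seminormed Z-modules without a
   common intermediate structure.  [algType] imposes 1 != 0. *)
HB.mixin Record isCstar (R : realType) (A : Type) & GRing.Algebra R[i] A := {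
  star : A -> A;
  cnorm : A -> R;
  starD : {morph star : x y / x + y};
  starZ : forall (a : R[i]) (x : A), star (a *: x) = conjc a *: star x;
  starM : forall x y : A, star (x * y) = star y * star x;
  starK : involutive star;
  cnormD : forall x y : A, cnorm (x + y) <= cnorm x + cnorm y;
  cnormZ : forall (a : R[i]) (x : A), cnorm (a *: x) = Normc.normc a * cnorm x;
  cnorm0_eq0 : forall x : A, cnorm x = 0 -> x = 0;
  cnormM : forall x y : A, cnorm (x * y) <= cnorm x * cnorm y;
  cnorm_starM : forall x : A, cnorm (star x * x) = cnorm x ^+ 2;
  cnorm_complete : forall u : nat -> A,
    (forall e, 0 < e -> exists N, forall m n, (N <= m)%N -> (N <= n)%N ->
       cnorm (u m - u n) < e) ->
    exists l : A, cnorm (u n - l) @[n --> \oo] --> (0 : R)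
}.

#[short(type="cstarType")]
HB.structure Definition Cstar (R : realType) :=
  {A of isCstar R A & GRing.Algebra R[i] A}.

Section CstarTheory.
Context {R : realType} {A : cstarType R}.
Implicit Types x y : A.

Lemma cnorm0 : cnorm (0 : A) = 0.
Proof. by rewrite -(scale0r 0) cnormZ Normc.normc0 mul0r. Qed.

Lemma cnormN x : cnorm (- x) = cnorm x.
Proof.
rewrite -scaleN1r cnormZ /=.
by rewrite oppr0 expr0n addr0 sqrrN expr1n sqrtr1 mul1r.
Qed.

Lemma cnorm_ge0 x : 0 <= cnorm x.
Proof.
have := cnormD x (- x); rewrite subrr cnorm0 cnormN -mulr2n.
by rewrite pmulrn_lge0.
Qed.

Lemma cnormB_sym x y : cnorm (x - y) = cnorm (y - x).
Proof. by rewrite -opprB cnormN. Qed.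

Lemma normc_ge0 (a : R[i]) : 0 <= Normc.normc a.
Proof. by case: a => ? ?; exact: sqrtr_ge0. Qed.

Lemma cnorm_star x : cnorm (star x) = cnorm x.
Proof.
suff le y : cnorm y <= cnorm (star y).
  by apply/eqP; rewrite eq_le le -{2}[x]starK le.
have [->|y0] := eqVneq (cnorm y) 0; first exact: cnorm_ge0.
have cy : 0 < cnorm y by rewrite lt_neqAle eq_sym y0 cnorm_ge0.
by rewrite -(ler_pM2r cy) -expr2 -cnorm_starM cnormM.
Qed.

Lemma starB x y : star (x - y) = star x - star y.
Proof.
by rewrite starD -scaleN1r starZ rmorphN rmorph1 scaleN1r.
Qed.
End CstarTheory.

Section Linf.
Context {R : realType} (A : cstarType R).

Definition linf_pred : {pred nat -> A} :=
  fun u => `[< exists M : R, forall n, cnorm (u n) <= M >].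





Lemma linf_subring : subring_closed linf_pred.
Proof.
split.
- by apply/asboolP; exists (cnorm (1 : A)) => n.
- move=> u v /asboolP[M uM] /asboolP[N vN].
  apply/asboolP; exists (M + N) => n.
  by rewrite (le_trans (cnormD _ _))// lerD// cnormN.
- move=> u v /asboolP[M uM] /asboolP[N vN].
  apply/asboolP; exists (M * N) => n.
  by rewrite (le_trans (cnormM _ _))// ler_pM// cnorm_ge0.
Qed.

Lemma linf_scaler : scaler_closed linf_pred.
Proof.
move=> a u /asboolP[M uM]; apply/asboolP; exists (Normc.normc a * M) => n.
rewrite cnormZ ler_wpM2l//.
by case: a => ? ?; exact: sqrtr_ge0.
Qed.

HB.instance Definition _ := GRing.isSubringClosed.Build (nat -> A) linf_pred linf_subring.
HB.instance Definition _ := GRing.isScaleClosed.Build R[i] (nat -> A) linf_pred linf_scaler.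

Record linf : Type := Linf { linf_val :> nat -> A; _ : linf_val \in linf_pred }.
HB.instance Definition _ := [isSub for linf_val].
HB.instance Definition _ := [Choice of linf by <:].
HB.instance Definition _ := [SubChoice_isSubNzRing of linf by <:].
HB.instance Definition _ := [SubZmodule_isSubLmodule of linf by <:].
Lemma linf_scalerAl (a : R[i]) (u v : linf) : a *: (u * v) = (a *: u) * v.
Proof. by apply: val_inj; apply/funext => n; rewrite /= [LHS]scalerAl. Qed.
HB.instance Definition _ := GRing.Lmodule_isLalgebra.Build R[i] linf linf_scalerAl.
Lemma linf_scalerAr (a : R[i]) (u v : linf) : a *: (u * v) = u * (a *: v).
Proof. by apply: val_inj; apply/funext => n; rewrite /= [LHS]scalerAr. Qed.
HB.instance Definition _ := GRing.Lalgebra_isAlgebra.Build R[i] linf linf_scalerAr.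

Definition c0_pred : {pred linf} :=
  fun u => `[< cnorm (u n) @[n --> \oo] --> (0 : R) >].

Lemma c0P (u : linf) : reflect (forall e : R, 0 < e ->
  \forall n \near \oo, cnorm (u n) < e) (u \in c0_pred).
Proof.
apply: (iffP idP) => [/asboolP/cvgr0Pnorm_lt u0 e e0|u0].
  by near do rewrite -[ltLHS]ger0_norm ?cnorm_ge0//; exact: u0.
apply/asboolP/cvgr0Pnorm_lt => e e0.
by near do rewrite ger0_norm ?cnorm_ge0//; exact: u0.
Unshelve. all: by end_near. Qed.

Lemma c0_zmod : zmod_closed c0_pred.
Proof.
split=> [|u v /c0P u0 /c0P v0]; apply/c0P => e e0.
  by apply: nearW => n; rewrite /= cnorm0.
near=> n; rewrite /= [ltRHS]splitr.
rewrite (le_lt_trans (cnormD _ _))// cnormN ltrD//; near: n.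
- by apply: u0; rewrite divr_gt0.
- by apply: v0; rewrite divr_gt0.
Unshelve. all: by end_near. Qed.

HB.instance Definition _ := GRing.isZmodClosed.Build linf c0_pred c0_zmod.

(* A^oo = l^oo(N, A) / c_0(N, A) *)
Definition Ainf := Quotient.quot c0_pred.
HB.instance Definition _ := GRing.Zmodule.on Ainf.
HB.instance Definition _ := EqQuotient.on Ainf.

Definition cls (u : linf) : Ainf := \pi_(Ainf) u.

Lemma clsK (x : Ainf) : cls (repr x) = x.
Proof. exact: reprK. Qed.

Lemma cls_eqP (u v : linf) : cls u = cls v <->
  forall e : R, 0 < e -> \forall n \near \oo, cnorm (u n - v n) < e.
Proof.
split=> [/eqP|uv]; last apply/eqP; rewrite /cls.
  by rewrite -Quotient.idealrBE => /c0P.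
by rewrite -Quotient.idealrBE; apply/c0P.
Qed.

Lemma clsB : {morph cls : u v / u - v}.
Proof. by move=> u v; rewrite /cls !piE. Qed.
HB.instance Definition _ := GRing.isZmodMorphism.Build linf Ainf cls clsB.


Lemma linfP (u : linf) : exists2 M : R, 0 < M & forall n, cnorm (u n) <= M.
Proof.
have /asboolP[M uM] := valP u; exists (Num.max 1 M) => [|n].
  by rewrite lt_max ltr01.
by rewrite le_max uM orbT.
Qed.

Definition Ainf_mul (x y : Ainf) : Ainf := cls (repr x * repr y).
Definition Ainf_scale (a : R[i]) (x : Ainf) : Ainf := cls (a *: repr x).

Lemma clsM u v : cls (u * v) = Ainf_mul (cls u) (cls v).
Proof.
have /cls_eqP uu : cls (repr (cls u)) = cls u by rewrite clsK.
have /cls_eqP vv : cls (repr (cls v)) = cls v by rewrite clsK.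
apply/cls_eqP; move: (repr (cls u)) (repr (cls v)) uu vv => u' v' uu vv e e0.
have [M M0 uM] := linfP u; have [N N0 vN] := linfP v'.
near=> n => /=.
rewrite -[X in cnorm X](subrKA (u n * v' n)) -mulrBr -mulrBl.
rewrite (le_lt_trans (cnormD _ _))// [ltRHS]splitr ltrD//.
  rewrite (le_lt_trans (cnormM _ _))//.
  rewrite (@le_lt_trans _ _ (M * cnorm (v n - v' n)))//.
    by rewrite ler_wpM2r ?cnorm_ge0.
  rewrite mulrC -ltr_pdivlMr// cnormB_sym; near: n; apply: vv.
  by rewrite !divr_gt0.
rewrite (le_lt_trans (cnormM _ _))//.
rewrite (@le_lt_trans _ _ (cnorm (u n - u' n) * N))//.
  by rewrite ler_wpM2l ?cnorm_ge0.
rewrite -ltr_pdivlMr// cnormB_sym; near: n; apply: uu.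
by rewrite !divr_gt0.
Unshelve. all: by end_near. Qed.


Lemma clsZ a u : cls (a *: u) = Ainf_scale a (cls u).
Proof.
have /cls_eqP uu : cls (repr (cls u)) = cls u by rewrite clsK.
apply/cls_eqP; move: (repr (cls u)) uu => u' uu e e0.
have a1 : 0 < Normc.normc a + 1 by rewrite ltr_wpDl ?normc_ge0.
near=> n => /=.
rewrite -[X in cnorm X]scalerBr cnormZ cnormB_sym.
rewrite (@le_lt_trans _ _ ((Normc.normc a + 1) * cnorm (u' n - u n)))//.
  by rewrite ler_wpM2r ?cnorm_ge0// lerDl.
rewrite mulrC -ltr_pdivlMr//; near: n; apply: uu.
by rewrite divr_gt0.
Unshelve. all: by end_near. Qed.

Lemma Ainf_mulA : associative Ainf_mul.
Proof.
move=> x y z; rewrite -(clsK x) -(clsK y) -(clsK z).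
by rewrite -!clsM mulrA.
Qed.
Lemma Ainf_mul1l : left_id (cls 1) Ainf_mul.
Proof. by move=> x; rewrite -(clsK x) -clsM mul1r. Qed.
Lemma Ainf_mul1r : right_id (cls 1) Ainf_mul.
Proof. by move=> x; rewrite -(clsK x) -clsM mulr1. Qed.
Lemma Ainf_mulDl : left_distributive Ainf_mul +%R.
Proof.
move=> x y z; rewrite -(clsK x) -(clsK y) -(clsK z).
by rewrite -raddfD -!clsM -raddfD mulrDl.
Qed.
Lemma Ainf_mulDr : right_distributive Ainf_mul +%R.
Proof.
move=> x y z; rewrite -(clsK x) -(clsK y) -(clsK z).
by rewrite -raddfD -!clsM -raddfD mulrDr.
Qed.
Lemma Ainf_1neq0 : cls 1 != 0.
Proof.
apply/eqP; rewrite -(raddf0 cls) => /cls_eqP /(_ (cnorm (1 : A))).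
have c1 : 0 < cnorm (1 : A).
  rewrite lt_neqAle cnorm_ge0 andbT eq_sym.
  by apply/eqP => /cnorm0_eq0/eqP; rewrite oner_eq0.
move=> /(_ c1)[N _ /(_ N (leqnn N))] /=.
by rewrite [X in cnorm X]subr0 ltxx.
Qed.
HB.instance Definition _ := GRing.Zmodule_isNzRing.Build Ainf
  Ainf_mulA Ainf_mul1l Ainf_mul1r Ainf_mulDl Ainf_mulDr Ainf_1neq0.

Lemma cls_monoid : monoid_morphism cls.
Proof. by split=> // u v; rewrite clsM. Qed.
HB.instance Definition _ := GRing.isMonoidMorphism.Build linf Ainf cls cls_monoid.

Lemma Ainf_scaleA a b (x : Ainf) : Ainf_scale a (Ainf_scale b x) = Ainf_scale (a * b) x.
Proof. by rewrite -(clsK x) -!clsZ scalerA. Qed.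
Lemma Ainf_scale1 : left_id 1 Ainf_scale.
Proof. by move=> x; rewrite -(clsK x) -!clsZ scale1r. Qed.
Lemma Ainf_scaleDr : right_distributive Ainf_scale +%R.
Proof.
move=> a x y; rewrite -(clsK x) -(clsK y).
by rewrite -raddfD -!clsZ -raddfD scalerDr.
Qed.
Lemma Ainf_scaleDl (x : Ainf) : {morph Ainf_scale^~ x : a b / a + b}.
Proof. by move=> a b; rewrite -(clsK x) -!clsZ -raddfD scalerDl. Qed.
HB.instance Definition _ := GRing.Zmodule_isLmodule.Build R[i] Ainf
  Ainf_scaleA Ainf_scale1 Ainf_scaleDr Ainf_scaleDl.

Lemma cls_scalable : scalable cls.
Proof. by move=> a u; rewrite clsZ. Qed.
HB.instance Definition _ := GRing.isScalable.Build R[i] linf Ainf *:%R cls cls_scalable.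


Lemma cls_mul u v : cls (u * v) = cls u * cls v. Proof. exact: clsM. Qed.
Lemma cls_scale a u : cls (a *: u) = a *: cls u. Proof. exact: clsZ. Qed.

Lemma Ainf_scaleAl (a : R[i]) (x y : Ainf) : a *: (x * y) = (a *: x) * y.
Proof.
rewrite -(clsK x) -(clsK y) -(cls_mul (repr x) (repr y)).
by rewrite -!cls_scale -cls_mul scalerAl.
Qed.
HB.instance Definition _ := GRing.Lmodule_isLalgebra.Build R[i] Ainf Ainf_scaleAl.
Lemma Ainf_scaleAr (a : R[i]) (x y : Ainf) : a *: (x * y) = x * (a *: y).
Proof.
rewrite -(clsK x) -(clsK y) -(cls_mul (repr x) (repr y)).
by rewrite -!cls_scale -cls_mul scalerAr.
Qed.
HB.instance Definition _ := GRing.Lalgebra_isAlgebra.Build R[i] Ainf Ainf_scaleAr.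


Lemma linf_star_subproof (u : linf) : star \o u \in linf_pred.
Proof.
have [M _ uM] := linfP u; apply/asboolP; exists M => n /=.
by rewrite cnorm_star.
Qed.
Definition linf_star (u : linf) : linf := Linf (linf_star_subproof u).

Definition Ainf_star (x : Ainf) : Ainf := cls (linf_star (repr x)).


Lemma cls_star u : cls (linf_star u) = Ainf_star (cls u).
Proof.
have /cls_eqP uu : cls (repr (cls u)) = cls u by rewrite clsK.
apply/cls_eqP => e /uu uue; near=> n => /=.
by rewrite -starB cnorm_star cnormB_sym; near: n.
Unshelve. all: by end_near. Qed.

Lemma Ainf_starD : {morph Ainf_star : x y / x + y}.
Proof.
move=> x y; rewrite -(clsK x) -(clsK y) -raddfD -!cls_star -raddfD.
by congr cls; apply/val_inj/funext => n /=; rewrite [LHS]starD.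
Qed.
Lemma Ainf_starZ (a : R[i]) (x : Ainf) :
  Ainf_star (a *: x) = conjc a *: Ainf_star x.
Proof.
rewrite -(clsK x) -cls_scale -!cls_star -cls_scale.
by congr cls; apply/val_inj/funext => n /=; rewrite [LHS]starZ.
Qed.
Lemma Ainf_starM (x y : Ainf) : Ainf_star (x * y) = Ainf_star y * Ainf_star x.
Proof.
rewrite -(clsK x) -(clsK y) -cls_mul -!cls_star -cls_mul.
by congr cls; apply/val_inj/funext => n /=; rewrite [LHS]starM.
Qed.
Lemma Ainf_starK : involutive Ainf_star.
Proof.
move=> x; rewrite -(clsK x) -!cls_star.
by congr cls; apply/val_inj/funext => n /=; rewrite starK.
Qed.

(* The quotient norm: the infimum of the sup norms of the representatives;
   [Ainf_norm_le] below identifies it with limsup_n |u n|. *)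
Definition Ainf_norm_set (x : Ainf) : set R :=
  [set r | exists2 u : linf, cls u = x & forall n, cnorm (u n) <= r].
Definition Ainf_norm (x : Ainf) : R := inf (Ainf_norm_set x).

Lemma Ainf_norm_has_inf x : has_inf (Ainf_norm_set x).
Proof.
split.
  have [M M0 uM] := linfP (repr x).
  by exists M; exists (repr x) => //; exact: clsK.
by exists 0 => r [u _ /(_ 0%N)]; apply: le_trans; exact: cnorm_ge0.
Qed.

Lemma Ainf_norm_ge0 x : 0 <= Ainf_norm x.
Proof.
apply: lb_le_inf; first by case: (Ainf_norm_has_inf x).
by move=> r [u _ /(_ 0%N)]; apply: le_trans; exact: cnorm_ge0.
Qed.

Lemma Ainf_norm_le u a : Ainf_norm (cls u) <= a <->
  forall e, 0 < e -> \forall n \near \oo, cnorm (u n) <= a + e.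
Proof.
split=> [ua e e0|ua].
  have e20 : 0 < e / 2 by rewrite divr_gt0.
  have [r [v /cls_eqP uv vr] rlt] := inf_adherent e20 (Ainf_norm_has_inf (cls u)).
  near=> n; rewrite -(subrK (v n) (u n)).
  rewrite (le_trans (cnormD _ _))// [leRHS](_ : _ = e / 2 + (a + e / 2)); last first.
    by rewrite addrCA -splitr.
  rewrite lerD//.
    by rewrite cnormB_sym ltW//; near: n; exact: uv.
  by rewrite (le_trans (vr n))// (le_trans (ltW rlt))// lerD2r.
apply/ler_addgt0Pr => e e0.
have [N _ uN] := ua e e0.
pose v n := if (n < N)%N then 0 else u n.
have ae0 : 0 <= a + e by rewrite (le_trans (cnorm_ge0 _) (uN N (leqnn N))).
have vae n : cnorm (v n) <= a + e.
  by rewrite /v; case: ltnP => [_|/uN//]; rewrite cnorm0.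
have vP : v \in linf_pred by apply/asboolP; exists (a + e).
apply: inf_lbound; first by case: (Ainf_norm_has_inf (cls u)).
exists (Linf vP) => //; apply/cls_eqP => d d0.
exists N => // n /= Nn; rewrite /v ltnNge Nn /=.
by rewrite subrr cnorm0.
Unshelve. all: by end_near. Qed.

Lemma Ainf_norm_near (u : linf) (e : R) : 0 < e ->
  \forall n \near \oo, cnorm (u n) <= Ainf_norm (cls u) + e.
Proof. by move=> e0; exact: (Ainf_norm_le u _).1. Qed.

Lemma Ainf_normD x y : Ainf_norm (x + y) <= Ainf_norm x + Ainf_norm y.
Proof.
rewrite -(clsK x) -(clsK y) -raddfD; apply/Ainf_norm_le => e e0.
near=> n; rewrite (le_trans (cnormD _ _))// [X in _ <= _ + X]splitr addrACA.
by rewrite lerD//; near: n; apply: Ainf_norm_near; rewrite divr_gt0.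
Unshelve. all: by end_near. Qed.

Lemma Ainf_normZ_le (a : R[i]) x :
  Ainf_norm (a *: x) <= Normc.normc a * Ainf_norm x.
Proof.
rewrite -(clsK x) -cls_scale; apply/Ainf_norm_le => e e0.
have a1 : 0 < Normc.normc a + 1 by rewrite ltr_wpDl ?normc_ge0.
near=> n; rewrite cnormZ.
rewrite (@le_trans _ _ (Normc.normc a *
    (Ainf_norm (cls (repr x)) + e / (Normc.normc a + 1))))//.
  rewrite ler_wpM2l ?normc_ge0//; near: n; apply: Ainf_norm_near.
  by rewrite divr_gt0.
rewrite mulrDr lerD2l mulrCA ger_pMr// ler_pdivrMr// mul1r.
by rewrite lerDl.
Unshelve. all: by end_near. Qed.

Lemma Ainf_normZ (a : R[i]) x : Ainf_norm (a *: x) = Normc.normc a * Ainf_norm x.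
Proof.
apply/eqP; rewrite eq_le Ainf_normZ_le/=.
have [->|a0] := eqVneq a 0; first by rewrite Normc.normc0 mul0r Ainf_norm_ge0.
have na0 : 0 < Normc.normc a.
  rewrite lt_neqAle normc_ge0 andbT eq_sym; apply/eqP => /Normc.eq0_normc/eqP.
  by rewrite (negbTE a0).
rewrite -[in leLHS](scale1r x) -(mulVf a0) -scalerA.
rewrite mulrC -ler_pdivlMr// (le_trans (Ainf_normZ_le _ _))//.
by rewrite Normc.normcV mulrC.
Qed.

Lemma Ainf_norm0_eq0 x : Ainf_norm x = 0 -> x = 0.
Proof.
rewrite -(clsK x) => x0; rewrite -(raddf0 cls); apply/cls_eqP => e e0.
near=> n; rewrite [X in cnorm X]subr0 (@le_lt_trans _ _ (e / 2))//.
  rewrite -[leRHS]add0r -x0; near: n; apply: Ainf_norm_near.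
  by rewrite divr_gt0.
by rewrite ltr_pdivrMr// ltr_pMr// ltr1n.
Unshelve. all: by end_near. Qed.

Lemma Ainf_normM x y : Ainf_norm (x * y) <= Ainf_norm x * Ainf_norm y.
Proof.
rewrite -(clsK x) -(clsK y) -cls_mul.
set p := Ainf_norm (cls (repr x)); set q := Ainf_norm (cls (repr y)).
have p0 : 0 <= p := Ainf_norm_ge0 _.
have q0 : 0 <= q := Ainf_norm_ge0 _.
apply/Ainf_norm_le => e e0.
pose d := Num.min 1 (e / (p + q + 1)).
have pq : 0 < p + q + 1 by rewrite ltr_wpDl// addr_ge0.
have d0 : 0 < d by rewrite lt_min ltr01 divr_gt0.
near=> n; rewrite (le_trans (cnormM _ _))//.
rewrite (@le_trans _ _ ((p + d) * (q + d)))//.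
  by rewrite ler_pM ?cnorm_ge0//; near: n; exact: Ainf_norm_near.
have -> : (p + d) * (q + d) = p * q + d * (p + q + d).
  by rewrite !mulrDl !mulrDr -!addrA (mulrC p d).
rewrite lerD2l (@le_trans _ _ (d * (p + q + 1)))//.
  by rewrite ler_pM2l// lerD2l ge_min lexx.
by rewrite -ler_pdivlMr// ge_min lexx orbT.
Unshelve. all: by end_near. Qed.

Lemma Ainf_norm_star x : Ainf_norm (Ainf_star x) <= Ainf_norm x.
Proof.
rewrite -(clsK x) -cls_star; apply/Ainf_norm_le => e e0.
by near=> n; rewrite cnorm_star; near: n; exact: Ainf_norm_near.
Unshelve. all: by end_near. Qed.

Lemma Ainf_norm_starM x : Ainf_norm (Ainf_star x * x) = Ainf_norm x ^+ 2.
Proof.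
apply/eqP; rewrite eq_le; apply/andP; split.
  rewrite (le_trans (Ainf_normM _ _))// expr2 ler_wpM2r ?Ainf_norm_ge0//.
  exact: Ainf_norm_star.
rewrite -(clsK x) -cls_star -cls_mul.
set s := Ainf_norm (cls (_ * _)).
have s0 : 0 <= s := Ainf_norm_ge0 _.
rewrite -[leRHS]sqr_sqrtr//.
rewrite ler_pXn2r ?nnegrE ?Ainf_norm_ge0 ?sqrtr_ge0//.
apply/Ainf_norm_le => e e0.
near=> n.
rewrite -(@ler_pXn2r _ 2) ?nnegrE ?cnorm_ge0 ?addr_ge0 ?sqrtr_ge0//; last exact: ltW.
rewrite -cnorm_starM (@le_trans _ _ (s + e ^+ 2))//.
  by near: n; apply: (Ainf_norm_near (linf_star (repr x) * repr x)); rewrite exprn_gt0.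
by rewrite sqrrD sqr_sqrtr// lerD2r lerDl mulrn_wge0// mulr_ge0 ?sqrtr_ge0// ltW.
Unshelve. all: by end_near. Qed.

Lemma Ainf_complete (x : nat -> Ainf) :
  (forall e, 0 < e -> exists N, forall m n, (N <= m)%N -> (N <= n)%N ->
     Ainf_norm (x m - x n) < e) ->
  exists l : Ainf, Ainf_norm (x n - l) @[n --> \oo] --> (0 : R).
Proof.
move=> xC.
pose d k : R := k.+1%:R^-1.
have d0 k : 0 < d k by rewrite invr_gt0.
have /choice[N xN] : forall k, exists N, forall m n, (N <= m)%N -> (N <= n)%N ->
    Ainf_norm (x m - x n) < d k by move=> k; exact: xC.
pose M k := \max_(i < k.+1) N i.
have NM j k : (j <= k)%N -> (N j <= M k)%N.
  by move=> jk; exact: (@leq_bigmax _ (fun i : 'I_k.+1 => N i) (Ordinal (jk : j < k.+1)%N)).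
pose v k := repr (x (M k)).
pose P k n := forall j, (j <= k)%N -> cnorm (v j n - v k n) <= 2 * d j.
have P0 n : P 0%N n.
  by move=> j; rewrite leqn0 => /eqP ->; rewrite subrr cnorm0 mulr_ge0// ltW.
have Pnear k : \forall n \near \oo, P k n.
  suff : \forall n \near \oo, forall j : 'I_k.+1, cnorm (v j n - v k n) <= 2 * d j.
    by apply: filterS => n Pn j jk; exact: (Pn (Ordinal (jk : j < k.+1)%N)).
  apply: filter_forall => j.
  near=> n; rewrite mulr_natl mulr2n.
  rewrite (@le_trans _ _ (Ainf_norm (cls (v j - v k)) + d j))//.
    by near: n; exact: (@Ainf_norm_near (v j - v k)).
  rewrite lerD2r clsB /v !clsK ltW// xN// NM//.
  by have := ltn_ord j; rewrite ltnS.
have /choice[k kP] : forall n, exists k, P k n /\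
    forall i, (i <= n)%N -> P i n -> (i <= k)%N.
  move=> n; pose Q i := (i <= n)%N && `[< P i n >].
  have Q0 : exists i, Q i by exists 0%N; apply/andP; split=> //; exact/asboolP.
  have Qn i : Q i -> (i <= n)%N by case/andP.
  case: (ex_maxnP Q0 Qn) => i /andP[_ /asboolP Pi] imax.
  exists i; split=> // j jn Pj; apply: imax.
  by rewrite /Q jn; exact/asboolP.
pose w n := v (k n) n.
have wP : w \in linf_pred.
  have [C C0 vC] := linfP (v 0%N).
  apply/asboolP; exists (2 * d 0%N + C) => n.
  rewrite -(subrK (v 0%N n) (w n)) (le_trans (cnormD _ _))// lerD//.
  by rewrite cnormB_sym; exact: (kP n).1.
have yw j : Ainf_norm (x (M j) - cls (Linf wP)) <= 2 * d j.
  rewrite -(clsK (x (M j))) -clsB; apply/Ainf_norm_le => e e0.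
  near=> n; rewrite (@le_trans _ _ (2 * d j))//; last by rewrite lerDl ltW.
  have jn : (j <= k n)%N.
    by apply: (kP n).2; near: n; [exact: nbhs_infty_ge|exact: Pnear].
  exact: ((kP n).1 j jn).
exists (cls (Linf wP)).
apply/cvgr0Pnorm_lt => e e0.
have e30 : 0 < e / 3 by rewrite divr_gt0.
have [j _ /(_ j (leqnn j)) /= dj] := near_infty_natSinv_lt (PosNum e30).
near=> n; rewrite ger0_norm ?Ainf_norm_ge0//.
rewrite -[X in Ainf_norm X](subrKA (x (M j))).
rewrite (le_lt_trans (Ainf_normD _ _))//.
rewrite (@lt_le_trans _ _ (d j + 2 * d j))//.
  rewrite ltr_leD//; apply: xN; last exact: NM.
  by near: n; exact: nbhs_infty_ge.
rewrite -[X in X + _]mul1r -mulrDl -ler_pdivlMl//.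
by rewrite (_ : 1 + 2 = 3 :> R) 1?mulrC 1?ltW// -natr1 addrC.
Unshelve. all: by end_near. Qed.

HB.instance Definition _ := isCstar.Build R Ainf Ainf_starD Ainf_starZ Ainf_starM
  Ainf_starK Ainf_normD Ainf_normZ Ainf_norm0_eq0 Ainf_normM Ainf_norm_starM
  Ainf_complete.

Lemma cst_linf_subproof (x : A) : (fun=> x) \in linf_pred.
Proof. by apply/asboolP; exists (cnorm x). Qed.

Definition const_inf (x : A) : Ainf := cls (Linf (cst_linf_subproof x)).

End Linf.

Section CstarNotions.
Context {R : realType} {A : cstarType R}.
Implicit Types (x y z p q : A) (B I P : set A).

Definition selfadjoint x := star x = x.

Definition projection p := selfadjoint p /\ p * p = p.

Definition invertible_in B x := exists2 y, B y & x * y = 1 /\ y * x = 1.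

Definition spectrum x : set R[i] :=
  [set l | ~ invertible_in [set: A] (x - l%:A)].

(* In the order of R[i], 0 <= l means that l is real and nonnegative. *)
Definition positive x := selfadjoint x /\ spectrum x `<=` [set l | 0 <= l].

Definition mvn_equiv p q := exists v, star v * v = p /\ v * star v = q.

Definition norm_closed B :=
  forall x, (forall e : R, 0 < e -> exists2 y, B y & cnorm (x - y) < e) -> B x.

Record cstar_subalgebra B : Prop := {
  csub0 : B 0;
  csubD : forall x y, B x -> B y -> B (x + y);
  csubZ : forall (a : R[i]) x, B x -> B (a *: x);
  csubM : forall x y, B x -> B y -> B (x * y);
  csub_star : forall x, B x -> B (star x);
  csub_closed : norm_closed B }.

Definition unital_cstar_subalgebra B := cstar_subalgebra B /\ B 1.

Definition hereditary B := cstar_subalgebra B /\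
  forall x y, B y -> positive x -> positive (y - x) -> B x.

Definition hereditary_generated z : set A :=
  [set x | forall B, hereditary B -> B z -> B x].

(* Stable under scaling since a *: x = (a *: 1) * x. *)
Record closed_ideal I : Prop := {
  cideal0 : I 0;
  cidealD : forall x y, I x -> I y -> I (x + y);
  cidealMl : forall x y, I y -> I (x * y);
  cidealMr : forall x y, I x -> I (x * y);
  cideal_closed : norm_closed I }.

(* For a unital C*-subalgebra B with the unit of A *)
Definition real_rank_zero B :=
  forall x, B x -> selfadjoint x -> forall e : R, 0 < e ->
    exists y, [/\ B y, selfadjoint y, invertible_in B y & cnorm (x - y) < e].

(* For a unital C*-subalgebra P.  A norm one projection onto P has all these
   properties (Tomiyama). *)
Record cond_exp P := CondExp {
  cexp :> {linear A -> A};
  cexp_range : forall x, P (cexp x);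
  cexp_id : forall x, P x -> cexp x = x;
  cexp_bimod : forall x y z, P x -> P z -> cexp (x * y * z) = x * cexp y * z;
  cexp_positive : forall x, positive x -> positive (cexp x);
  cexp_contractive : forall x, cnorm (cexp x) <= cnorm x }.

Definition quasi_basis (E : A -> A) (s : seq (A * A)) := forall x,
  x = \sum_(w <- s) w.1 * E (w.2 * x) /\ x = \sum_(w <- s) E (x * w.1) * w.2.

Definition index_finite (E : A -> A) := exists s, quasi_basis E s.

(* Computed from an arbitrary quasi-basis, see [IndexE] *)
Definition Index (E : A -> A) : A :=
  \sum_(w <- xget [::] [set s | quasi_basis E s]) w.1 * w.2.

Lemma IndexE (E : A -> A) s :
  quasi_basis E s -> Index E = \sum_(w <- s) w.1 * w.2.
Proof.
rewrite /Index; case: xgetP => [t _ /= Et Es|/(_ s)//].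
transitivity (\sum_(w <- t) \sum_(w' <- s) w.1 * (E (w.2 * w'.1) * w'.2)).
  by apply: eq_bigr => w _; rewrite -mulr_sumr -(Es w.2).2.
rewrite exchange_big/=; apply: eq_bigr => w' _.
rewrite [in RHS](Et w'.1).1 mulr_suml.
by apply: eq_bigr => w _; rewrite mulrA.
Qed.

End CstarNotions.

Definition simple_cstar (R : realType) (A : cstarType R) :=
  forall I : set A, closed_ideal I -> I = [set 0] \/ I = [set: A].

Section TracialRokhlin.
Context {R : realType} {A : cstarType R} {P : set A} (E : cond_exp P).

Lemma cexp_linf_subproof (u : linf A) : E \o u \in @linf_pred R A.
Proof.
have [M _ uM] := linfP u; apply/asboolP; exists M => n /=.
exact: le_trans (cexp_contractive _ _) (uM n).
Qed.

Definition cexp_linf (u : linf A) : linf A := Linf (cexp_linf_subproof u).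

(* E^oo, as a map from A^oo to itself with range in P^oo *)
Definition Einf (x : Ainf A) : Ainf A := cls (cexp_linf (repr x)).

Lemma Einf_cls (u : linf A) : Einf (cls u) = cls (cexp_linf u).
Proof.
have /cls_eqP uu : cls (repr (cls u)) = cls u by rewrite clsK.
apply/cls_eqP => e /uu uue; near=> n => /=.
rewrite -raddfB (le_lt_trans (cexp_contractive _ _))//.
by near: n.
Unshelve. all: by end_near. Qed.

Definition Pinf : set (Ainf A) := [set cls u | u in [set u : linf A | forall n, P (u n)]].

Lemma Einf_range x : Pinf (Einf x).
Proof. by exists (cexp_linf (repr x)) => // n; exact: cexp_range. Qed.

Definition tracial_rokhlin := forall z : Ainf A, positive z -> z <> 0 ->
  exists e : Ainf A,
    [/\ projection e,
        forall x : A, const_inf x * e = e * const_inf x,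
        let g := const_inf (Index E) * Einf e in
          projection g /\
          exists q, [/\ projection q, hereditary_generated z q & mvn_equiv (1 - g) q]
      & injective (fun x : A => const_inf x * e)].

End TracialRokhlin.

(* Main.v *)
Require Import Defs.
From HB Require Import structures.
From mathcomp Require Import all_boot all_order all_algebra.
From mathcomp Require Import complex ring lra.
From mathcomp Require Import all_classical all_reals.
From mathcomp Require Import topology normedtype sequences.

(** Write [lam] for the index, a scalar because [A] is simple, and [F] for the
    expectation that [E] induces on sequences.  A Rokhlin projection [e] with
    [g = lam F(e)] gives [phi a = lam F(e a)], a *-homomorphism from [A] to the
    corner of [Pinf] cut by [g], with [phi p = g p] for [p] in [P] ([phiM],
    [phi_fix]).  If [g] were [1], then [phi y] would be an invertible element of
    [Pinf] near [x = phi x] as soon as [y] is an invertible element of [A] near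
    [x], and real rank zero would pass to [P].

    The corner [1 - g] is absorbed into a small projection, in two steps.

    Unless [x] is already invertible, [A] contains a nonzero projection [r] with
    [x r] small ([rr0_small_projection]); [phi r] is a projection of [Pinf] that
    [x] almost kills, and it is lifted to a projection [p] of [P]
    ([small_projection]).  So [x] may be replaced by [(1 - p) x (1 - p)].

    Given one Rokhlin projection [e1], a second one [e] is chosen with [1 - g]
    equivalent, in [Ainf], to a subprojection of [p e1]; this is where it matters
    that the small element in the Rokhlin property may be any element of [Ainf].
    If [v] implements the equivalence then [e1 v = v], and
    [w = sqrt lam F(v)], which lies in [Pinf], satisfies [w^* w = 1 - g] and
    [p w = w] ([rokhlin_transfer]).  So [1 - g] is small relative to [p] inside
    [Pinf] itself.  On the sum of [(1 - g) (1 - p)] and [p] the matrix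
    [[x, t], [t, 0]] built from [w] is invertible for every [t <> 0]; on
    [g (1 - p)] one takes [phi y] with [y] invertible in the corner of [1 - p] and
    close to [x] ([rr0_corner]).  The sum is invertible, self-adjoint and close to
    [x] ([patch_inv]), and an entry far along a representing sequence is the
    required element of [P] ([Pinf_lift]).

    Both the multiplicativity of [phi] and the transfer rest on the identity
    [e y = lam e F(e y)] ([rokhlin_left]).  In terms of the Jones projection [e_P]
    it says that the projection [lam e e_P e], which lies below [e], equals [e].
    Their difference is a projection on the Hilbert module [A] whose value under
    the dual expectation is [0]; [trace0_eq0] shows that such a projection
    vanishes.

    The order structure of C*-algebras is derived from norm estimates: [pos]
    is positivity read off the norm, [positive_pos] and [pos_positive] compare it
    with the spectrum, and [pos_starM] is the positivity of [x^* x]. *)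

Set Implicit Arguments.
Unset Strict Implicit.
Unset Printing Implicit Defensive.
Import Order.TTheory GRing.Theory Num.Theory.
Import numFieldNormedType.Exports.

Local Open Scope classical_set_scope.
Local Open Scope ring_scope.
Local Open Scope complex_scope.

(** * Deciding identities in noncommutative algebras *)

Section NcReflection.
Context {K : comNzRingType} {A : algType K}.

(** Noncommutative polynomials over [K].  The scalars stay symbolic, so that an
    identity reduces to commutative ones between its coefficients. *)
Inductive ncexpr :=
  | NcVar of nat | NcZero | NcOne
  | NcAdd of ncexpr & ncexpr | NcOpp of ncexpr
  | NcMul of ncexpr & ncexpr | NcScale of K & ncexpr.

Fixpoint nc_eval (env : seq A) (e : ncexpr) : A :=
  match e with
  | NcVar n => nth 0 env n
  | NcZero => 0
  | NcOne => 1
  | NcAdd a b => nc_eval env a + nc_eval env b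
  | NcOpp a => - nc_eval env a
  | NcMul a b => nc_eval env a * nc_eval env b
  | NcScale k a => k *: nc_eval env a
  end.

Fixpoint nc_word (env : seq A) (w : seq nat) : A :=
  if w is n :: w' then nth 0 env n * nc_word env w' else 1.

Fixpoint nc_sum (env : seq A) (s : seq (K * seq nat)) : A :=
  if s is m :: s' then m.1 *: nc_word env m.2 + nc_sum env s' else 0.

Fixpoint nc_mul1 (m : K * seq nat) (s : seq (K * seq nat)) :=
  if s is m' :: s' then (m.1 * m'.1, m.2 ++ m'.2) :: nc_mul1 m s' else [::].

Fixpoint nc_mul (s t : seq (K * seq nat)) :=
  if s is m :: s' then nc_mul1 m t ++ nc_mul s' t else [::].

Fixpoint nc_scale (k : K) (s : seq (K * seq nat)) :=
  if s is m :: s' then (k * m.1, m.2) :: nc_scale k s' else [::].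

Fixpoint nc_norm (e : ncexpr) : seq (K * seq nat) :=
  match e with
  | NcVar n => [:: (1, [:: n])]
  | NcZero => [::]
  | NcOne => [:: (1, [::])]
  | NcAdd a b => nc_norm a ++ nc_norm b
  | NcOpp a => nc_scale (-1) (nc_norm a)
  | NcMul a b => nc_mul (nc_norm a) (nc_norm b)
  | NcScale k a => nc_scale k (nc_norm a)
  end.

Fixpoint nc_eqw (v w : seq nat) : bool :=
  match v, w with
  | [::], [::] => true
  | m :: v', n :: w' => Nat.eqb m n && nc_eqw v' w'
  | _, _ => false
  end.

Fixpoint nc_insert (m : K * seq nat) (s : seq (K * seq nat)) :=
  if s is m' :: s' then
    if nc_eqw m.2 m'.2 then (m.1 + m'.1, m.2) :: s' else m' :: nc_insert m s'
  else [:: m].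

Fixpoint nc_collect (s : seq (K * seq nat)) :=
  if s is m :: s' then nc_insert m (nc_collect s') else [::].

Fixpoint nc_all0 (s : seq (K * seq nat)) : Prop :=
  if s is m :: s' then m.1 = 0 /\ nc_all0 s' else True.

Lemma nc_eqwP v w : nc_eqw v w -> v = w.
Proof.
elim: v w => [|m v IH] [|n w] //= /andP[/PeanoNat.Nat.eqb_eq -> /IH ->//].
Qed.

Lemma nc_word_cat env v w : nc_word env (v ++ w) = nc_word env v * nc_word env w.
Proof. by elim: v => [|n v IH] /=; rewrite ?mul1r// IH mulrA. Qed.

Lemma nc_sum_cat env s t : nc_sum env (s ++ t) = nc_sum env s + nc_sum env t.
Proof. by elim: s => [|m s IH] /=; rewrite ?add0r// IH addrA. Qed.

Lemma nc_sum_scale env k s : nc_sum env (nc_scale k s) = k *: nc_sum env s.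
Proof. by elim: s => [|m s IH] /=; rewrite ?scaler0// IH scalerDr scalerA. Qed.

Lemma nc_sum_mul env s t : nc_sum env (nc_mul s t) = nc_sum env s * nc_sum env t.
Proof.
elim: s => [|m s IH] /=; first by rewrite mul0r.
rewrite nc_sum_cat IH mulrDl; congr (_ + _).
elim: t {IH} => [|m' t IH] /=; first by rewrite mulr0.
by rewrite mulrDr -scalerAl -scalerAr nc_word_cat IH scalerA.
Qed.

Lemma nc_normE env e : nc_eval env e = nc_sum env (nc_norm e).
Proof.
elim: e => //=.
- by move=> n; rewrite scale1r mulr1 addr0.
- by rewrite scale1r addr0.
- by move=> a -> b ->; rewrite nc_sum_cat.
- by move=> a ->; rewrite nc_sum_scale scaleN1r.
- by move=> a -> b ->; rewrite nc_sum_mul.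
- by move=> k a ->; rewrite nc_sum_scale.
Qed.

Lemma nc_collectE env s : nc_sum env (nc_collect s) = nc_sum env s.
Proof.
elim: s => //= m s <-; elim: (nc_collect s) => //= m' t IH.
case: ifP => [/nc_eqwP E|_] /=; first by rewrite E scalerDl addrA.
by rewrite IH addrCA.
Qed.

Lemma nc_all0P env s : nc_all0 s -> nc_sum env s = 0.
Proof. by elim: s => //= m s IH [-> /IH ->]; rewrite scale0r addr0. Qed.

Lemma nc_correct env a b :
  nc_all0 (nc_collect (nc_norm (NcAdd a (NcOpp b)))) ->
  nc_eval env a = nc_eval env b.
Proof.
move=> /(nc_all0P env); rewrite nc_collectE -nc_normE /= => /eqP.
by rewrite subr_eq0 => /eqP.
Qed.

End NcReflection.

Ltac nc_index x env :=
  lazymatch env with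
  | x :: _ => constr:(0%N)
  | _ :: ?env' => let n := nc_index x env' in constr:(S n)
  end.

Ltac nc_add x env :=
  match env with
  | context [x :: _] => env
  | _ => constr:(x :: env)
  end.

Ltac nc_atoms t env :=
  lazymatch t with
  | @GRing.add _ ?a ?b => let env := nc_atoms a env in nc_atoms b env
  | @GRing.mul _ ?a ?b => let env := nc_atoms a env in nc_atoms b env
  | @GRing.opp _ ?a => nc_atoms a env
  | @GRing.scale _ _ _ ?a => nc_atoms a env
  | @GRing.natmul _ ?a _ => nc_atoms a env
  | @GRing.exp _ ?a _ => nc_atoms a env
  | @GRing.zero _ => env
  | @GRing.one _ => env
  | _ => nc_add t env
  end.

Ltac nc_iter op e n z :=
  lazymatch n with
  | O => z
  | S O => e
  | S ?m => let p := nc_iter op e m z in constr:(op e p)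
  end.

Ltac nc_reify K t env :=
  lazymatch t with
  | @GRing.add _ ?a ?b =>
    let a := nc_reify K a env in let b := nc_reify K b env in
    constr:(@NcAdd K a b)
  | @GRing.mul _ ?a ?b =>
    let a := nc_reify K a env in let b := nc_reify K b env in
    constr:(@NcMul K a b)
  | @GRing.opp _ ?a => let a := nc_reify K a env in constr:(@NcOpp K a)
  | @GRing.scale _ _ ?k ?a =>
    let a := nc_reify K a env in constr:(@NcScale K k a)
  | @GRing.natmul _ ?a ?n =>
    let a := nc_reify K a env in
    let n := eval compute in n in
    nc_iter (@NcAdd K) a n (@NcZero K)
  | @GRing.exp _ ?a ?n =>
    let a := nc_reify K a env in
    let n := eval compute in n in
    nc_iter (@NcMul K) a n (@NcOne K)
  | @GRing.zero _ => constr:(@NcZero K)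
  | @GRing.one _ => constr:(@NcOne K)
  | _ => let n := nc_index t env in constr:(@NcVar K n)
  end.

Ltac nc_coefs :=
  lazymatch goal with
  | |- True => exact I
  | |- _ /\ _ => split; [try ring | nc_coefs]
  end.

(** Each word in the atoms leaves one goal, the vanishing of its coefficient,
    which [ring] decides in the scalars. *)
Ltac nc_ring :=
  lazymatch goal with
  | |- @eq ?T ?a ?b =>
    let R := match T with context [?A] =>
               match type of A with Cstar.type ?R => R end end in
    let K := constr:((R[i])%C : comNzRingType) in
    let K := lazymatch K with (?k : _) => k end in
    let env := nc_atoms a (@nil T) in
    let env := nc_atoms b env in
    let ea := nc_reify K a env in
    let eb := nc_reify K b env in
    refine (@nc_correct K _ env ea eb _);
    cbn [nc_norm nc_collect nc_insert nc_eqw nc_mul nc_mul1 nc_scale nc_all0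
         cat Nat.eqb andb fst snd];
    nc_coefs
  end.

(** * Convergence, Neumann series and square roots *)

Section Basics.
Context {R : realType} {A : cstarType R}.
Implicit Types (x y a b d : A) (t : R).

Lemma normc_real t : Normc.normc t%:C = `|t|.
Proof. by rewrite /= expr0n addr0 sqrtr_sqr. Qed.

Lemma cnorm_real t x : cnorm (t%:C *: x) = `|t| * cnorm x.
Proof. by rewrite cnormZ normc_real. Qed.

Lemma star1 : star (1 : A) = 1.
Proof. by rewrite -[LHS]mulr1 -{2}[1](@starK _ A) -starM mulr1 starK. Qed.

Lemma star0 : star (0 : A) = 0.
Proof. by rewrite -[0 in LHS](subrr 0) starB subrr. Qed.

Lemma starN x : star (- x) = - star x.
Proof. by rewrite -[- x]add0r starB star0 add0r. Qed.

Lemma star_real t x : star (t%:C *: x) = t%:C *: star x.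
Proof. by rewrite starZ /= oppr0. Qed.

Lemma star_sum I (r : seq I) (F : I -> A) :
  star (\sum_(i <- r) F i) = \sum_(i <- r) star (F i).
Proof. exact: (big_morph _ (@starD R A) star0). Qed.

Lemma cnorm1 : cnorm (1 : A) = 1.
Proof.
have := cnorm_starM (1 : A); rewrite star1 mulr1 => /eqP.
rewrite expr2 -[X in X == _]mulr1 -subr_eq0 -mulrBr mulf_eq0 => /orP[/eqP/cnorm0_eq0/eqP|].
  by rewrite oner_eq0.
by rewrite subr_eq0 => /eqP.
Qed.

Lemma cnorm_sqr x : selfadjoint x -> cnorm (x * x) = cnorm x ^+ 2.
Proof. by rewrite -cnorm_starM => ->. Qed.

Lemma cnorm_realA t : cnorm (t%:C%:A : A) = `|t|.
Proof. by rewrite cnorm_real cnorm1 mulr1. Qed.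

Lemma cnorm_sum I (r : seq I) (F : I -> A) :
  cnorm (\sum_(i <- r) F i) <= \sum_(i <- r) cnorm (F i).
Proof.
elim/big_rec2: _ => [|i y z _ IH]; first by rewrite cnorm0.
by rewrite (le_trans (cnormD _ _))// lerD2l.
Qed.

Lemma cnormB_tri z x y : cnorm (x - y) <= cnorm (x - z) + cnorm (z - y).
Proof. by rewrite -[x - y](subrKA z) (le_trans (cnormD _ _)). Qed.

Lemma cnorm_eq0P x : (forall e : R, 0 < e -> cnorm x <= e) -> x = 0.
Proof.
move=> h; apply: cnorm0_eq0; apply/eqP; rewrite eq_le cnorm_ge0 andbT.
by apply/ler_addgt0Pr => e e0; rewrite add0r h.
Qed.

Definition ccvg (u : nat -> A) (l : A) :=
  forall e : R, 0 < e -> exists N, forall n, (N <= n)%N -> cnorm (u n - l) < e.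

Lemma ccvg_unique u l m : ccvg u l -> ccvg u m -> l = m.
Proof.
move=> ul um; apply/eqP; rewrite -subr_eq0; apply/eqP/cnorm_eq0P => e e0.
have e2 : 0 < e / 2 by rewrite divr_gt0.
have [N hN] := ul _ e2; have [M hM] := um _ e2.
rewrite (le_trans (cnormB_tri (u (maxn N M)) _ _))// [leRHS]splitr.
by apply: lerD; apply: ltW; [rewrite cnormB_sym hN ?leq_maxl|rewrite hM ?leq_maxr].
Qed.

Lemma ccvg_cst a : ccvg (fun=> a) a.
Proof. by move=> e e0; exists 0%N => n _; rewrite subrr cnorm0. Qed.

Lemma ccvgD u v l m : ccvg u l -> ccvg v m -> ccvg (fun n => u n + v n) (l + m).
Proof.
move=> ul vm e e0; have e2 : 0 < e / 2 by rewrite divr_gt0.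
have [N hN] := ul _ e2; have [M hM] := vm _ e2.
exists (maxn N M) => n; rewrite geq_max => /andP[Nn Mn].
rewrite opprD addrACA (le_lt_trans (cnormD _ _))// [ltRHS]splitr.
by apply: ltrD; [exact: hN|exact: hM].
Qed.

Lemma ccvg_star u l : ccvg u l -> ccvg (fun n => star (u n)) (star l).
Proof.
move=> ul e /ul[N hN]; exists N => n Nn.
by rewrite -starB cnorm_star hN.
Qed.

Lemma ccvgZ c u l : ccvg u l -> ccvg (fun n => c *: u n) (c *: l).
Proof.
move=> ul e e0; have c1 : 0 < Normc.normc c + 1 by rewrite ltr_wpDl ?normc_ge0.
have [|N hN] := ul (e / (Normc.normc c + 1)); first by rewrite divr_gt0.
exists N => n /hN; rewrite -scalerBr cnormZ ltr_pdivlMr// => h.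
by rewrite (le_lt_trans _ h)// mulrC ler_wpM2l ?cnorm_ge0// lerDl.
Qed.

Lemma ccvgM u v l m : ccvg u l -> ccvg v m -> ccvg (fun n => u n * v n) (l * m).
Proof.
move=> ul vm e e0.
pose M := cnorm l + cnorm m + 1.
have M0 : 0 < M by rewrite ltr_wpDl// addr_ge0 ?cnorm_ge0.
have d0 : 0 < Num.min 1 (e / M) by rewrite lt_min ltr01 divr_gt0.
have [N hN] := ul _ d0; have [K hK] := vm _ d0.
exists (maxn N K) => n; rewrite geq_max => /andP[/hN + /hK].
move: (u n) (v n) => p q; rewrite !lt_min => /andP[h1 h2] /andP[h3 h4].
have -> : p * q - l * m = (p - l) * (q - m) + (p - l) * m + l * (q - m) by nc_ring.
move: h2 h4; rewrite !ltr_pdivlMr// => h2 h4.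
have cl := cnorm_ge0 l; have cm := cnorm_ge0 m.
have cp := cnorm_ge0 (p - l); have cq := cnorm_ge0 (q - m).
have := cnormM (p - l) (q - m); have := cnormM (p - l) m; have := cnormM l (q - m).
have := cnormD ((p - l) * (q - m) + (p - l) * m) (l * (q - m)).
have := cnormD ((p - l) * (q - m)) ((p - l) * m).
have [hm|hm] := lerP (cnorm (p - l)) (cnorm (q - m)).
  move: h4; rewrite /M; nra.
move: h2; rewrite /M; nra.
Qed.

Lemma eq_ccvg (u u' : nat -> A) l : u =1 u' -> ccvg u l -> ccvg u' l.
Proof. by move=> /funext ->. Qed.

Lemma ccvg_sum I (r : seq I) (F : I -> nat -> A) :
  (forall i, ccvg (F i) 0) -> ccvg (fun n => \sum_(i <- r) F i n) 0.
Proof.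
move=> h; elim: r => [|i r IH].
  by apply: eq_ccvg (ccvg_cst 0) => n; rewrite big_nil.
apply: (@eq_ccvg (fun n => F i n + \sum_(j <- r) F j n)) => [n|].
  by rewrite big_cons.
have := ccvgD (h i) IH; rewrite addr0; exact.
Qed.

Lemma ccvg_shift u l : ccvg u l -> ccvg (fun n => u n.+1) l.
Proof. by move=> ul e /ul[N hN]; exists N => n Nn; apply: hN; rewrite ltnW. Qed.

Lemma ccvg_norm_le u l (M : R) : ccvg u l -> (forall n, cnorm (u n) <= M) ->
  cnorm l <= M.
Proof.
move=> ul uM; apply/ler_addgt0Pr => e /ul[N /(_ N (leqnn N)) h].
rewrite -[l](subKr (u N)) (le_trans (cnormD _ _))// cnormN lerD//.
exact: ltW.
Qed.

(** A sequence of increments dominated by those of a bounded real sequence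
    converges: the completeness used for the Neumann series and for square
    roots. *)
Lemma ccvg_majorant (u : nat -> A) (v : nat -> R) (M : R) :
  (forall n, cnorm (u n.+1 - u n) <= v n.+1 - v n) -> (forall n, v n <= M) ->
  exists l, ccvg u l.
Proof.
move=> uv vM.
have uvle m n : (n <= m)%N -> cnorm (u m - u n) <= v m - v n.
  elim: m => [|m IH]; first by rewrite leqn0 => /eqP ->; rewrite !subrr cnorm0.
  rewrite leq_eqVlt => /orP[/eqP ->|]; first by rewrite !subrr cnorm0.
  rewrite ltnS => /IH h; rewrite (le_trans (cnormB_tri (u m) _ _))//.
  by rewrite -[v m.+1 - v n](subrKA (v m)) lerD.
have vmono m n : (n <= m)%N -> v n <= v m.
  by move=> /uvle h; rewrite -subr_ge0 (le_trans _ h) ?cnorm_ge0.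
have hs : has_sup (range v).
  by split; [exists (v 0%N), 0%N | exists M => _ [n _ <-]].
have cauchy e : 0 < e -> exists N, forall m n, (N <= n)%N -> (n <= m)%N ->
    cnorm (u m - u n) < e.
  move=> e0; have [_ [N _ <-] hN] := sup_adherent e0 hs.
  exists N => m n Nn nm; rewrite (le_lt_trans (uvle _ _ nm))//.
  have := vmono _ _ Nn; have : v m <= sup (range v) by apply: sup_ubound; [exact: hs.2|exists m].
  lra.
have [|l /cvgr0Pnorm_lt ul] := cnorm_complete u.
  move=> e /cauchy[N hN]; exists N => m n Nm Nn.
  have [/hN|/ltnW/hN] := leqP n m; first exact.
  by rewrite cnormB_sym; exact.
exists l => e /ul[N _ hN]; exists N => n /hN /=.
by rewrite ger0_norm// cnorm_ge0.
Qed.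

Lemma ccvg_closed (B : set A) u l : norm_closed B -> (forall n, B (u n)) ->
  ccvg u l -> B l.
Proof.
move=> cB Bu ul; apply: cB => e /ul[N /(_ N (leqnn N)) h].
by exists (u N) => //; rewrite cnormB_sym.
Qed.

(** Closure under [star] is not asked for: the commutant of one element is the
    main instance. *)
Record closed_alg (B : set A) : Prop := {
  calg1 : B 1;
  calgD : forall x y, B x -> B y -> B (x + y);
  calgZ : forall (c : R[i]) x, B x -> B (c *: x);
  calgM : forall x y, B x -> B y -> B (x * y);
  calg_closed : norm_closed B }.

Lemma closed_alg_commutant c : closed_alg [set x | c * x = x * c].
Proof.
split => /=.
- by rewrite mulr1 mul1r.
- by move=> x y hx hy; rewrite mulrDr mulrDl hx hy.
- by move=> k x hx; rewrite -scalerAr -scalerAl hx.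
- by move=> x y hx hy; rewrite mulrA hx -mulrA hy mulrA.
- move=> x h; apply/eqP; rewrite -subr_eq0; apply/eqP/cnorm_eq0P => e e0.
  have c1 : 0 < 2 * cnorm c + 1 by rewrite ltr_wpDl// mulr_ge0 ?cnorm_ge0.
  have [|y /= hy] := h (e / (2 * cnorm c + 1)); first by rewrite divr_gt0.
  rewrite ltr_pdivlMr// => hxy.
  have -> : c * x - x * c = c * (x - y) - (x - y) * c + (c * y - y * c) by nc_ring.
  rewrite hy subrr addr0 (le_trans (cnormD _ _))// cnormN.
  have := cnormM c (x - y); have := cnormM (x - y) c; have := cnorm_ge0 (x - y); nra.
Qed.

Lemma neumann x : cnorm x < 1 -> exists y, (1 - x) * y = 1 /\ y * (1 - x) = 1.
Proof.
move=> x1; have x0 := cnorm_ge0 x.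
pose q := cnorm x; pose u n := iter n (fun y => 1 + x * y) 0.
have uS n : u n.+1 = 1 + x * u n by [].
have q1 : 0 < 1 - q by rewrite subr_gt0.
have inc n : cnorm (u n.+1 - u n) <= q ^+ n.
  elim: n => [|n IH]; first by rewrite uS mulr0 addr0 subr0 cnorm1.
  rewrite 2!uS opprD addrACA subrr add0r -mulrBr (le_trans (cnormM _ _))//.
  by rewrite exprS ler_wpM2l.
have [l ul] : exists l, ccvg u l.
  apply: (@ccvg_majorant u (fun n => (1 - q ^+ n) / (1 - q)) (1 / (1 - q))) => n.
    rewrite (le_trans (inc n))// -mulrBl exprS ler_pdivlMr//; nra.
  by rewrite ler_pM2r ?invr_gt0// gerBl exprn_ge0.
have xu n : x * u n = u n * x.
  elim: n => [|n IH]; first by rewrite mulr0 mul0r.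
  by rewrite uS mulrDr mulrDl mulr1 mul1r -mulrA -IH.
have e1 : l = 1 + x * l.
  apply: (ccvg_unique (ccvg_shift ul)).
  by apply: (ccvgD (ccvg_cst _)); apply: (ccvgM (ccvg_cst _)).
have e2 : x * l = l * x.
  apply: (ccvg_unique (ccvgM (ccvg_cst x) ul)).
  by under [X in ccvg X]eq_fun do rewrite xu; exact: (ccvgM ul (ccvg_cst x)).
exists l; split.
  by rewrite mulrBl mul1r {1}e1 addrK.
by rewrite mulrBr mulr1 -e2 {1}e1 addrK.
Qed.

(** The Riesz-Nagy iteration y' = (x + y^2)/2 converges to 1 - sqrt (1 - x);
    comparison with the same iteration at x = 1, which increases to 1, covers
    the boundary case of norm one, where a power series argument would need
    the summability of the binomial coefficients. *)
Lemma sqrt_1m x : selfadjoint x -> cnorm x <= 1 ->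
  exists y, [/\ selfadjoint y, cnorm y <= cnorm x, (1 - y) * (1 - y) = 1 - x
    & forall B, closed_alg B -> B x -> B y].
Proof.
move=> sx x1; have x0 := cnorm_ge0 x.
pose h : R := 2^-1; have h0 : 0 < h by rewrite invr_gt0.
have hh : h + h = 1 by rewrite /h; lra.
pose u n := iter n (fun y => h%:C *: (x + y * y)) 0.
have uS n : u n.+1 = h%:C *: (x + u n * u n) by [].
pose v n : R := iter n (fun y : R => h * (1 + y * y)) 0.
have vS n : v n.+1 = h * (1 + v n * v n) by [].
have v01 n : 0 <= v n /\ v n <= 1.
  elim: n => [|n [IH1 IH2]]; first by split=> //; exact: ler01.
  rewrite vS; split; first by rewrite mulr_ge0 ?(ltW h0)// addr_ge0// mulr_ge0.
  have : v n * v n <= 1 by nra.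
  nra.
have uv n : cnorm (u n) <= v n.
  elim: n => [|n IH]; first by rewrite cnorm0.
  rewrite uS vS cnorm_real gtr0_norm// ler_pM2l//.
  rewrite (le_trans (cnormD _ _))// lerD// (le_trans (cnormM _ _))//.
  by rewrite ler_pM ?cnorm_ge0.
have ux n : cnorm (u n) <= cnorm x.
  elim: n => [|n IH]; first by rewrite cnorm0 cnorm_ge0.
  rewrite uS cnorm_real gtr0_norm//.
  have := cnormD x (u n * u n); have := cnormM (u n) (u n).
  have := cnorm_ge0 (u n); nra.
have [l ul] : exists l, ccvg u l.
  apply: (@ccvg_majorant u v 1) => [|n]; last by have [] := v01 n.
  elim=> [|n IH].
    rewrite uS vS /= !mulr0 !addr0 !subr0 mulr1 cnorm_real gtr0_norm//; nra.
  rewrite 2!uS 2!vS -scalerBr cnorm_real gtr0_norm//.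
  rewrite -uS -vS.
  have -> : x + u n.+1 * u n.+1 - (x + u n * u n) =
     u n.+1 * (u n.+1 - u n) + (u n.+1 - u n) * u n by nc_ring.
  have := cnormD (u n.+1 * (u n.+1 - u n)) ((u n.+1 - u n) * u n).
  have := cnormM (u n.+1) (u n.+1 - u n); have := cnormM (u n.+1 - u n) (u n).
  have := uv n; have := uv n.+1; have := cnorm_ge0 (u n); have := cnorm_ge0 (u n.+1).
  move: IH; have := cnorm_ge0 (u n.+1 - u n).
  move: (cnorm _) (cnorm (u n.+1 * _)) (cnorm (_ * u n)) (cnorm (u n)) (cnorm (u n.+1)).
  move=> e a b p q e0 he p0 q0 hq hp hb ha habs.
  have -> : h * (1 + v n.+1 * v n.+1) - h * (1 + v n * v n) =
    h * (v n.+1 * (v n.+1 - v n) + (v n.+1 - v n) * v n) by ring.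
  rewrite ler_pM2l// (le_trans habs)// lerD//.
    by rewrite (le_trans ha)// ler_pM.
  by rewrite (le_trans hb)// ler_pM.
exists l; split.
- apply: (ccvg_unique (ccvg_star ul)).
  suff su n : star (u n) = u n by under [X in ccvg X]eq_fun do rewrite su.
  elim: n => [|n IH]; first by rewrite star0.
  by rewrite uS star_real starD starM IH sx.
- exact: ccvg_norm_le ul ux.
- have e1 : l = h%:C *: (x + l * l).
    apply: (ccvg_unique (ccvg_shift ul)); apply: ccvgZ.
    by apply: (ccvgD (ccvg_cst _)); exact: ccvgM.
  have e2 : l + l = x + l * l.
    by rewrite {1 2}e1 -scalerDl -rmorphD /= hh scale1r.
  have -> : x = l + l - l * l by rewrite e2 addrK.
  nc_ring.
- move=> B cB Bx; apply: (ccvg_closed (calg_closed cB) _ ul).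
  have B0 : B 0 by rewrite -(scale0r 1); apply: (calgZ cB); exact: calg1 cB.
  elim=> [//|n IH]; rewrite uS; apply: (calgZ cB); apply: (calgD cB) => //.
  exact: (calgM cB).
Qed.

End Basics.

(** * Positive elements *)

Section Positivity.
Context {R : realType} {A : cstarType R}.
Implicit Types (x y a b d p q s : A) (t : R).

Lemma mulii : 'i%C * 'i%C = -1 :> R[i].
Proof. by rewrite -expr2 sqr_i. Qed.

Lemma scaleVK t x : t != 0 -> t^-1%:C *: (t%:C *: x) = x.
Proof. by move=> t0; rewrite scalerA -rmorphM /= mulVf// scale1r. Qed.

Lemma scaleKV t x : t != 0 -> t%:C *: (t^-1%:C *: x) = x.
Proof. by move=> t0; rewrite scalerA -rmorphM /= divff// scale1r. Qed.

Lemma selfadjoint_real t : selfadjoint (t%:C%:A : A).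
Proof. by rewrite /selfadjoint star_real star1. Qed.

Lemma selfadjointD x y : selfadjoint x -> selfadjoint y -> selfadjoint (x + y).
Proof. by rewrite /selfadjoint starD => -> ->. Qed.

Lemma selfadjointB x y : selfadjoint x -> selfadjoint y -> selfadjoint (x - y).
Proof. by rewrite /selfadjoint starB => -> ->. Qed.

Lemma selfadjointN x : selfadjoint x -> selfadjoint (- x).
Proof. by rewrite /selfadjoint starN => ->. Qed.

Lemma selfadjointZ t x : selfadjoint x -> selfadjoint (t%:C *: x).
Proof. by rewrite /selfadjoint star_real => ->. Qed.

Lemma selfadjointM x y : selfadjoint x -> selfadjoint y -> x * y = y * x ->
  selfadjoint (x * y).
Proof. by rewrite /selfadjoint starM => -> ->. Qed.

Lemma selfadjoint_starM x : selfadjoint (star x * x).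
Proof. by rewrite /selfadjoint starM starK. Qed.

Lemma selfadjoint_conj x a : selfadjoint a -> selfadjoint (star x * a * x).
Proof. by rewrite /selfadjoint !starM starK mulrA => ->. Qed.

(** Norm positivity: the spectrum of [d] lies in a disc [|t - z| <= t].  It
    agrees with spectral positivity, but sums, limits and unital contractions
    visibly preserve it. *)
Definition pos d := selfadjoint d /\
  exists2 t, 0 <= t & cnorm (t%:C%:A - d) <= t.

Lemma pos_sa d : pos d -> selfadjoint d. Proof. by case. Qed.

Lemma pos_real t : 0 <= t -> pos (t%:C%:A).
Proof.
move=> t0; split; first exact: selfadjoint_real.
by exists t => //; rewrite subrr cnorm0.
Qed.

Lemma pos0 : pos 0.
Proof. by rewrite -(scale0r 1); exact: (@pos_real 0). Qed.

Lemma posD p q : pos p -> pos q -> pos (p + q).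
Proof.
move=> [sp [t t0 tp]] [sq [u u0 uq]]; split; first exact: selfadjointD.
exists (t + u); first exact: addr_ge0.
rewrite rmorphD scalerDl /= opprD addrACA (le_trans (cnormD _ _))//.
exact: lerD.
Qed.

Lemma posZ t p : 0 <= t -> pos p -> pos (t%:C *: p).
Proof.
move=> t0 [sp [u u0 up]]; split; first exact: selfadjointZ.
exists (t * u); first exact: mulr_ge0.
by rewrite rmorphM -scalerA -scalerBr cnorm_real ger0_norm// ler_wpM2l.
Qed.

Lemma pos_sum I (r : seq I) (F : I -> A) :
  (forall i, pos (F i)) -> pos (\sum_(i <- r) F i).
Proof. by move=> h; elim/big_rec: _ => [|i x _]; [exact: pos0|exact: posD]. Qed.

Lemma closed_alg0 B : closed_alg B -> B (0 : A).
Proof. by move=> cB; rewrite -(scale0r 1); apply: (calgZ cB); exact: calg1 cB. Qed.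

Lemma closed_algB B x y : closed_alg B -> B x -> B y -> B (x - y).
Proof.
move=> cB Bx By; apply: (calgD cB) => //; rewrite -scaleN1r.
exact: (calgZ cB).
Qed.

Lemma pos_sqrt d : pos d -> exists s,
  [/\ pos s, s * s = d & forall B, closed_alg B -> B d -> B s].
Proof.
move=> [sd [t t0 td]].
have [t00|tn0] := eqVneq t 0.
  move: td; rewrite t00 scale0r sub0r cnormN => d0.
  have {}d0 : d = 0 by apply: cnorm0_eq0; apply/eqP; rewrite eq_le d0 cnorm_ge0.
  by exists 0; split; [exact: pos0|rewrite mul0r d0|move=> B /closed_alg0].
have tp : 0 < t by rewrite lt_neqAle eq_sym tn0.
have [||y [sy y1 ey By]] := @sqrt_1m R A (1 - t^-1%:C *: d).
- by apply: selfadjointB; [exact: star1|exact: selfadjointZ].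
- have -> : 1 - t^-1%:C *: d = t^-1%:C *: (t%:C%:A - d).
    by rewrite scalerBr scalerA -rmorphM /= mulVf// scale1r.
  by rewrite cnorm_real gtr0_norm ?invr_gt0// mulrC ler_pdivrMr// mul1r.
have y1' : cnorm y <= 1.
  apply: (le_trans y1).
  have -> : 1 - t^-1%:C *: d = t^-1%:C *: (t%:C%:A - d).
    by rewrite scalerBr scalerA -rmorphM /= mulVf// scale1r.
  by rewrite cnorm_real gtr0_norm ?invr_gt0// mulrC ler_pdivrMr// mul1r.
exists ((Num.sqrt t)%:C *: (1 - y)); split.
- split; first by apply: selfadjointZ; apply: selfadjointB; first exact: star1.
  exists (Num.sqrt t); first exact: sqrtr_ge0.
  rewrite -scalerBr subKr cnorm_real ger0_norm ?sqrtr_ge0//.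
  by rewrite ler_piMr ?sqrtr_ge0.
- rewrite -scalerAl -scalerAr scalerA -rmorphM /= -expr2 sqr_sqrtr// ey subKr.
  by rewrite scalerA -rmorphM /= divff// scale1r.
- move=> B cB Bd; apply: (calgZ cB); apply: closed_algB => //; first exact: calg1 cB.
  apply: By => //; apply: closed_algB => //; first exact: calg1 cB.
  exact: (calgZ cB).
Qed.

Lemma pos_sqrt_comm d : pos d -> exists s,
  [/\ pos s, s * s = d & forall c, c * d = d * c -> c * s = s * c].
Proof.
move=> /pos_sqrt[s [ps ss Bs]]; exists s; split=> // c cd.
exact: (Bs _ (closed_alg_commutant c)).
Qed.

(** [a + i s] is [t] times a unitary and [a] is its real part. *)
Lemma circle_norm a s t : 0 <= t -> selfadjoint a -> selfadjoint s ->
  a * s = s * a -> a * a + s * s = (t ^+ 2)%:C%:A -> cnorm a <= t.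
Proof.
move=> t0 sa ss as_ eas.
pose u := a + 'i%C *: s.
have su : star u = a - 'i%C *: s.
  rewrite starD starZ sa ss; congr (_ + _); rewrite -scaleNr; congr (_ *: _).
  by apply/eqP; rewrite eq_complex /= oppr0 !eqxx.
have uu : star u * u = (t ^+ 2)%:C%:A.
  rewrite su (_ : _ * u = a * a + 'i%C *: (a * s - s * a) - ('i%C * 'i%C) *: (s * s)).
    by rewrite as_ subrr scaler0 addr0 mulii scaleN1r opprK.
  rewrite /u; nc_ring.
have nu : cnorm u <= t.
  rewrite -(@ler_pXn2r _ 2) ?nnegrE ?cnorm_ge0// -cnorm_starM uu.
  by rewrite cnorm_realA ger0_norm// exprn_ge0.
have -> : a = 2^-1%:C *: (u + star u).
  rewrite su /u -[LHS]scale1r -[1]/(1%:C) [1 in LHS](splitr (1 : R)) div1r; nc_ring.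
rewrite cnorm_real gtr0_norm ?invr_gt0// mulrC ler_pdivrMr//.
by rewrite (le_trans (cnormD _ _))// cnorm_star mulr_natr mulr2n lerD.
Qed.

(** [b] and [sqrt (1 - b^2)] are the two coordinates of a unitary, so both are
    contractions. *)
Lemma sq_ball1 b : selfadjoint b -> cnorm b <= 1 -> cnorm (1 - b * b) <= 1.
Proof.
move=> sb b1.
have [||y [sy y1 ey By]] := @sqrt_1m R A (b * b).
- exact: selfadjointM.
- by rewrite cnorm_sqr// expr_le1 ?cnorm_ge0.
have by_ : b * y = y * b.
  by apply: (By _ (closed_alg_commutant b)) => /=; rewrite mulrA.
have s1y : selfadjoint (1 - y) by apply: selfadjointB => //; exact: star1.
rewrite -ey cnorm_sqr// expr_le1 ?cnorm_ge0//.
apply: (@circle_norm _ b) => //.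
  by rewrite mulrBr mulrBl mul1r mulr1 by_.
by rewrite ey subrK expr1n scale1r.
Qed.

Lemma sq_ball b t : selfadjoint b -> cnorm (b * b) <= t ->
  cnorm (t%:C%:A - b * b) <= t.
Proof.
move=> sb bt; have t0 : 0 <= t := le_trans (cnorm_ge0 _) bt.
have [t00|tn0] := eqVneq t 0.
  move: bt; rewrite t00 => bt; suff -> : b * b = 0 by rewrite scale0r subrr cnorm0.
  by apply: cnorm0_eq0; apply/eqP; rewrite eq_le bt cnorm_ge0.
have tp : 0 < t by rewrite lt_neqAle eq_sym tn0.
have qp : 0 < Num.sqrt t by rewrite sqrtr_gt0.
pose c := (Num.sqrt t)^-1%:C *: b.
have cc : c * c = t^-1%:C *: (b * b).
  rewrite -scalerAl -scalerAr scalerA -rmorphM /= -invfM -expr2.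
  by rewrite sqr_sqrtr.
have c1 : cnorm (1 - c * c) <= 1.
  apply: sq_ball1; first exact: selfadjointZ.
  rewrite cnorm_real gtr0_norm ?invr_gt0// mulrC ler_pdivrMr// mul1r.
  rewrite -(@ler_pXn2r _ 2) ?nnegrE ?cnorm_ge0 ?(ltW qp)//.
  by rewrite sqr_sqrtr// -cnorm_sqr.
have -> : t%:C%:A - b * b = t%:C *: (1 - c * c).
  by rewrite cc scalerBr scalerA -rmorphM /= divff// scale1r.
by rewrite cnorm_real gtr0_norm// ler_piMr.
Qed.

Lemma pos_sq b : selfadjoint b -> pos (b * b).
Proof.
move=> sb; split; first exact: selfadjointM.
by exists (cnorm (b * b)); [exact: cnorm_ge0|exact: sq_ball].
Qed.

Lemma pos_ball d t : pos d -> cnorm d <= t -> cnorm (t%:C%:A - d) <= t.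
Proof. by move=> /pos_sqrt[s [[ss _] <- _]]; exact: sq_ball. Qed.

Lemma ball_pos d t : selfadjoint d -> cnorm d <= t -> pos (t%:C%:A - d).
Proof.
move=> sd dt; split; first by apply: selfadjointB => //; exact: selfadjoint_real.
by exists t; [exact: le_trans (cnorm_ge0 _) dt|rewrite subKr].
Qed.

Lemma ball_posD d t : selfadjoint d -> cnorm d <= t -> pos (t%:C%:A + d).
Proof.
by move=> sd dt; rewrite -[d]opprK; apply: ball_pos; [exact: selfadjointN|rewrite cnormN].
Qed.

(** Commuting square roots multiply to a self-adjoint square root. *)
Lemma pos_mul_comm p q : pos p -> pos q -> p * q = q * p -> pos (p * q).
Proof.
move=> /pos_sqrt_comm[s [[ss _] <- sc]] pq pqp.
have qs : q * s = s * q by exact: sc.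
have [r [[sr _] rr rc]] := pos_sqrt_comm pq.
have sr_ : s * r = r * s by apply: rc.
rewrite -rr (_ : _ * _ = (s * r) * (s * r)).
  by apply: pos_sq; exact: selfadjointM.
by rewrite !mulrA -(mulrA s r s) -sr_ !mulrA.
Qed.

(** [q - t/2] and the square root of [q (t - q)] lie on the circle of radius
    [t/2]. *)
Lemma pos_norm_le q t : pos q -> pos (t%:C%:A - q) -> cnorm q <= t.
Proof.
move=> pq ptq.
have t0 : 0 <= t.
  have [_ [u u0]] := posD pq ptq; rewrite [q + _]addrC subrK -scalerBl -rmorphB /=.
  by rewrite cnorm_realA ler_norml => /andP[_]; rewrite gerBl.
have : pos (q * (t%:C%:A - q)) by apply: pos_mul_comm => //; nc_ring.
move=> /pos_sqrt_comm[s [[ss _] es sc]].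
have qs : q * s = s * q by apply: sc; nc_ring.
pose h := t / 2; have hh : h + h = t by rewrite /h -splitr.
have h0 : 0 <= h by rewrite divr_ge0.
have : cnorm (q - h%:C%:A) <= h.
  apply: (@circle_norm _ s) => //.
  - by apply: selfadjointB; [case: pq|exact: selfadjoint_real].
  - by rewrite mulrBl mulrBr qs -scalerAl -scalerAr mul1r mulr1.
  - rewrite es -hh; nc_ring.
move=> qh; rewrite -[q](subrK h%:C%:A) (le_trans (cnormD _ _))//.
by rewrite cnorm_realA ger0_norm// -[in leRHS]hh lerD2r.
Qed.

Lemma pos_antisym d : pos d -> pos (- d) -> d = 0.
Proof.
move=> pd pnd; apply: cnorm0_eq0; apply/eqP; rewrite eq_le cnorm_ge0 andbT.
by apply: pos_norm_le => //; rewrite scale0r sub0r.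
Qed.

Lemma pos_sum_eq0 (I : eqType) (r : seq I) (F : I -> A) :
  (forall i, pos (F i)) -> \sum_(i <- r) F i = 0 ->
  forall i, i \in r -> F i = 0.
Proof.
move=> pF; elim: r => // i r IH; rewrite big_cons => h.
have e : F i = - \sum_(j <- r) F j by apply/eqP; rewrite -addr_eq0 h.
have e0 : F i = 0 by apply: pos_antisym => //; rewrite e opprK; exact: pos_sum.
have {}IH := IH _; move=> j; rewrite in_cons => /orP[/eqP ->//|]; apply: IH.
by move: h; rewrite e0 add0r.
Qed.

(** [T] is an orthogonal projection on the right Hilbert module [A] with inner
    product [<x, y> = E (star x * y)].  With a quasi-basis [(w_i, star w_i)] the
    trace of [T] would be the sum of [T w_i * star (T w_i)], and its vanishing
    would give [T = 0] at once.  For an arbitrary quasi-basis [(u_i, v_i)] put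
    [w_i = u_i + star v_i]; then [S x], the sum of the [w_i <w_i, x>], is bounded
    and at least [2].  For a multiple [1 - Q] of [S] with [0 <= Q <= rho < 1],
    the expansion
      [1 + Q = sum_(k < n) (1 - Q) ((1 + Q) Q^k)^2 + Q^(2 n) (1 + Q)]
    shows that [T (1 + Q) T] has nonnegative trace, like [T (1 - Q) T].  The
    two add up to twice the trace of [T], so both vanish. *)
Lemma pos_le_norm p q : pos p -> pos (q - p) -> cnorm p <= cnorm q.
Proof.
move=> pp pqp; apply: pos_norm_le => //.
rewrite -[_ - p](subrKA q); apply: posD => //.
apply: ball_pos => //; rewrite -[q](subrK p).
by apply: selfadjointD; exact: pos_sa.
Qed.

Lemma pos_closed d :
  (forall e : R, 0 < e -> exists2 p, pos p & cnorm (d - p) <= e) -> pos d.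
Proof.
move=> h.
have sd : selfadjoint d.
  apply/eqP; rewrite -subr_eq0; apply/eqP/cnorm_eq0P => e e0.
  have [|p pp dp] := h (e / 2); first by rewrite divr_gt0.
  rewrite (le_trans (cnormB_tri p _ _))// [leRHS]splitr.
  by apply: lerD; rewrite 1?cnormB_sym// -{1}(pos_sa pp) -starB cnorm_star cnormB_sym.
split=> //; exists (cnorm d + 1); first by rewrite addr_ge0 ?cnorm_ge0.
apply/ler_addgt0Pr => e e0.
have [|p pp dp] := h (Num.min 1 e); first by rewrite lt_min ltr01.
move: dp; rewrite le_min => /andP[d1 de].
rewrite (le_trans (cnormB_tri p _ _))// lerD//; last by rewrite cnormB_sym.
apply: pos_ball => //; rewrite -[p](subrK d) (le_trans (cnormD _ _))//.
by rewrite addrC lerD2l cnormB_sym.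
Qed.

End Positivity.

Section Spectrum.
Context {R : realType} {A : cstarType R}.
Implicit Types (x y a b d p q s : A) (t : R).

Definition inv x := exists y, x * y = 1 /\ y * x = 1.

Lemma inv_inT x : invertible_in [set: A] x <-> inv x.
Proof. by split=> [[y _ h]|[y h]]; exists y. Qed.

Lemma inv_factor x y : inv (x * y) -> inv (y * x) -> inv x.
Proof.
move=> [u [u1 u2]] [v [v1 v2]]; exists (y * u).
have -> : y * u = v * y.
  by rewrite -[LHS]mul1r -v2 -!mulrA (mulrA x) u1 mulr1.
by split; rewrite -?mulrA// -[v * y](_ : y * u = _) ?mulrA//
  -[LHS]mul1r -v2 -!mulrA (mulrA x) u1 mulr1.
Qed.

Lemma invM x y : inv x -> inv y -> inv (x * y).
Proof.
move=> [u [u1 u2]] [v [v1 v2]]; exists (v * u).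
split; first by rewrite mulrA -(mulrA x y v) v1 mulr1 u1.
by rewrite mulrA -(mulrA v u x) u2 mulr1 v2.
Qed.

Lemma inv_near1 x : cnorm (1 - x) < 1 -> inv x.
Proof. by move=> /neumann[y]; rewrite subKr => h; exists y. Qed.

Lemma invZ t x : t != 0 -> inv (t%:C *: x) <-> inv x.
Proof.
move=> t0; split=> [[y [h1 h2]]|[y [h1 h2]]].
  exists (t%:C *: y); split; first by rewrite -scalerAr scalerAl.
  by rewrite -scalerAl scalerAr.
exists (t^-1%:C *: y).
by rewrite -!scalerAl -!scalerAr !scalerA -!rmorphM /= mulVf ?divff// !scale1r.
Qed.

Lemma pos_addr_inv d t : pos d -> 0 < t -> inv (d + t%:C%:A).
Proof.
move=> [sd [u u0 ud]] t0.
have w0 : 0 < u + t by rewrite ltr_wpDl.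
have wn : (u + t)^-1 != 0 by rewrite invr_neq0// gt_eqF.
apply/(invZ _ wn); apply: inv_near1.
have -> : 1 - (u + t)^-1%:C *: (d + t%:C%:A) = (u + t)^-1%:C *: (u%:C%:A - d).
  rewrite -[X in X - _](scale1r 1) -[1 in X in X - _]/(1%:C).
  rewrite -(mulVf (lt0r_neq0 w0)).
  rewrite rmorphM /= -scalerA -scalerBr rmorphD scalerDl /=; congr (_ *: _); nc_ring.
rewrite cnorm_real gtr0_norm ?invr_gt0// mulrC ltr_pdivrMr// mul1r.
by rewrite (le_lt_trans ud)// ltrDl.
Qed.

(** [(b - i t) (b + i t) = b^2 + t^2] for the self-adjoint [b = a - r]. *)
Lemma sa_nonreal_inv a (r i : R) : selfadjoint a -> i != 0 ->
  inv (a - (r +i* i)%:A).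
Proof.
move=> sa i0.
pose b := a - r%:C%:A.
have sb : selfadjoint b by apply: selfadjointB => //; exact: selfadjoint_real.
have e : (r +i* i) = r%:C + 'i%C * i%:C.
  by apply/eqP; rewrite eq_complex /=; apply/andP; split; apply/eqP; ring.
have -> : a - (r +i* i)%:A = b - ('i%C * i%:C)%:A.
  by rewrite e scalerDl opprD addrA.
have i2 : ('i%C * i%:C) * ('i%C * i%:C) = - (i ^+ 2)%:C.
  by rewrite mulrACA mulii -rmorphM mulN1r.
have h : inv (b * b + (i ^+ 2)%:C%:A).
  by apply: pos_addr_inv; [exact: pos_sq|rewrite exprn_even_gt0].
set k := 'i%C * i%:C in i2 *.
have e1 : (b - k%:A) * (b + k%:A) = b * b + (i ^+ 2)%:C%:A.
  by rewrite -[(i ^+ 2)%:C]opprK -i2; nc_ring.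
have e2 : (b + k%:A) * (b - k%:A) = b * b + (i ^+ 2)%:C%:A.
  by rewrite -[(i ^+ 2)%:C]opprK -i2; nc_ring.
by apply: (@inv_factor _ (b + k%:A)); rewrite ?e1 ?e2.
Qed.

Lemma pos_positive d : pos d -> positive d.
Proof.
move=> pd; split; first exact: pos_sa.
move=> [r i]; rewrite /spectrum /= inv_inT => h.
have [i0|i0] := eqVneq i 0; last by case: h; apply: sa_nonreal_inv => //; exact: pos_sa.
rewrite i0 lecE /= eqxx /=; rewrite leNgt; apply/negP => r0; apply: h.
rewrite i0 -[r +i* 0]/(r%:C) -scaleNr -rmorphN /=.
by apply: pos_addr_inv => //; rewrite oppr_gt0.
Qed.

(** The bound is the inverse of the norm of [d^-1]. *)
Lemma pos_inv_ge d : pos d -> inv d -> exists2 c, 0 < c & pos (d - c%:C%:A).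
Proof.
move=> pd [h [h1 h2]].
have sd := pos_sa pd.
have sh : selfadjoint h.
  by rewrite /selfadjoint -[star h]mulr1 -h1 mulrA -{1}sd -starM h1 star1 mul1r.
have [s [[ss _] es sc]] := pos_sqrt_comm pd.
have hs : h * s = s * h by apply: sc; rewrite h1 h2.
have ph : pos h.
  rewrite (_ : h = (s * h) * (s * h)); first by apply: pos_sq; exact: selfadjointM.
  by rewrite mulrA -(mulrA s h s) hs mulrA es h1 mul1r.
have h0 : 0 < cnorm h.
  rewrite lt_neqAle cnorm_ge0 andbT eq_sym; apply/eqP => /cnorm0_eq0 h0.
  by move: h1; rewrite h0 mulr0 => /esym/eqP; rewrite oner_eq0.
exists (cnorm h)^-1; first by rewrite invr_gt0.
have -> : d - (cnorm h)^-1%:C%:A = (cnorm h)^-1%:C *: (d * ((cnorm h)%:C%:A - h)).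
  rewrite mulrBr h1 -scalerAr mulr1 scalerBr scalerA -rmorphM /=.
  by rewrite mulVf ?scale1r// gt_eqF.
apply: posZ; first by rewrite invr_ge0 ltW.
apply: pos_mul_comm => //; first exact: ball_pos.
by rewrite mulrBr mulrBl h1 h2 -scalerAl -scalerAr mulr1 mul1r.
Qed.

Lemma sa_norm_le b t : 0 <= t -> pos (t%:C%:A - b) -> pos (t%:C%:A + b) ->
  cnorm b <= t.
Proof.
move=> t0 h1 h2.
have sb : selfadjoint b.
  by rewrite -[b](subKr t%:C%:A); apply: selfadjointB (pos_sa h1); exact: selfadjoint_real.
have := pos_mul_comm h1 h2.
have -> : (t%:C%:A - b) * (t%:C%:A + b) = (t ^+ 2)%:C%:A - b * b by nc_ring.
move=> /(_ _)/(pos_norm_le (pos_sq sb)); rewrite cnorm_sqr// => h.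
rewrite -(@ler_pXn2r _ 2) ?nnegrE ?cnorm_ge0//; apply: h; nc_ring.
Qed.

(** If both [t - a] and [t + a] were invertible for [t] the norm of [a], then
    [t^2 - a^2] would be bounded below by a positive constant, and the norm of
    [a^2] would be less than [t^2]. *)
Lemma sa_norm_spectrum a : selfadjoint a ->
  ~ (inv ((cnorm a)%:C%:A - a) /\ inv ((cnorm a)%:C%:A + a)).
Proof.
move=> sa [i1 i2]; have := invM i1 i2.
have -> : ((cnorm a)%:C%:A - a) * ((cnorm a)%:C%:A + a)
    = (cnorm a ^+ 2)%:C%:A - a * a by nc_ring.
move=> /pos_inv_ge[|c c0].
  by apply: ball_pos; [exact: selfadjointM|rewrite cnorm_sqr].
have -> : (cnorm a ^+ 2)%:C%:A - a * a - c%:C%:A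
    = (cnorm a ^+ 2 - c)%:C%:A - a * a by nc_ring.
move=> /(pos_norm_le (pos_sq sa)); rewrite cnorm_sqr//; lra.
Qed.

Lemma norm_lt_inv d t : cnorm d < t -> inv (d - t%:C%:A).
Proof.
move=> dt; have t0 : 0 < t := le_lt_trans (cnorm_ge0 _) dt.
have tn : - t^-1 != 0 by rewrite oppr_eq0 invr_neq0// gt_eqF.
apply/(invZ _ tn); apply: inv_near1.
have -> : 1 - (- t^-1)%:C *: (d - t%:C%:A) = t^-1%:C *: d.
  rewrite rmorphN scaleNr opprK scalerBr scalerA -rmorphM /= mulVf ?gt_eqF// scale1r.
  nc_ring.
by rewrite cnorm_real gtr0_norm ?invr_gt0// mulrC ltr_pdivrMr// mul1r.
Qed.

(** The spectrum of [|d| - d] contains plus or minus its norm, so spectral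
    positivity of [d] bounds that norm by [|d|]. *)
Lemma positive_pos d : positive d -> pos d.
Proof.
move=> [sd spd]; split=> //; exists (cnorm d); first exact: cnorm_ge0.
set a := _ - d; set t := cnorm d in a *.
have sa : selfadjoint a by apply: selfadjointB => //; exact: selfadjoint_real.
rewrite leNgt; apply/negP => ta.
apply: (sa_norm_spectrum sa); split.
  rewrite (_ : _ - a = d - (t - cnorm a)%:C%:A); last by rewrite /a; nc_ring.
  apply: contrapT => h.
  have /spd : spectrum d (t - cnorm a)%:C by rewrite /spectrum /= inv_inT.
  by rewrite /= lecE /= eqxx /= subr_ge0 leNgt ta.
rewrite (_ : _ + a = (-1)%:C *: (d - (t + cnorm a)%:C%:A)); last by rewrite /a; nc_ring.
apply/invZ; first by rewrite oppr_eq0 oner_eq0.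
apply: norm_lt_inv; rewrite ltrDl; apply: le_lt_trans ta; exact: cnorm_ge0.
Qed.

(** Off zero, [x y] and [y x] have the same spectrum: the inverse of
    [y x - t] comes from the geometric series. *)
Lemma inv_swap x y t : t != 0 -> inv (x * y - t%:C%:A) -> inv (y * x - t%:C%:A).
Proof.
move=> t0 [u [u1 u2]].
exists (t^-1%:C *: (y * u * x - 1)).
have e1 : x * y * u = 1 + t%:C *: u.
  by rewrite -[x * y](subrK t%:C%:A) mulrDl u1 -scalerAl mul1r.
have e2 : u * (x * y) = 1 + t%:C *: u.
  by rewrite -[x * y](subrK t%:C%:A) mulrDr u2 -scalerAr mulr1.
have e0 : t^-1%:C *: (t%:C%:A : A) = 1.
  by rewrite scalerA -rmorphM /= mulVf// scale1r.
split; rewrite -?scalerAr -?scalerAl -[RHS]e0; congr (_ *: _).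
  have -> : (y * x - t%:C%:A) * (y * u * x - 1) =
    y * (x * y * u) * x - y * x - t%:C *: (y * u * x) + t%:C%:A by nc_ring.
  rewrite e1; nc_ring.
have -> : (y * u * x - 1) * (y * x - t%:C%:A) =
  y * (u * (x * y)) * x - y * x - t%:C *: (y * u * x) + t%:C%:A by nc_ring.
rewrite e2; nc_ring.
Qed.

Lemma pos_addstar x : pos (star x * x + x * star x).
Proof.
pose h := star x + x; pose k := 'i%C *: (star x - x).
have sh : selfadjoint h by rewrite /selfadjoint /h starD starK addrC.
have sk : selfadjoint k.
  rewrite /selfadjoint /k starZ starB starK -[X in _ *: X]opprB scalerN -scaleNr.
  by congr (_ *: _); apply/eqP; rewrite eq_complex /= oppr0 opprK !eqxx.
have -> : star x * x + x * star x = 2^-1%:C *: (h * h + k * k).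
  have -> : k * k = - ((star x - x) * (star x - x)).
    by rewrite /k -scalerAl -scalerAr scalerA mulii scaleN1r.
  have -> : h * h + - ((star x - x) * (star x - x)) =
     (2 : R)%:C *: (star x * x + x * star x) by rewrite /h; nc_ring.
  by rewrite scaleVK ?pnatr_eq0.
apply: posZ; first by rewrite invr_ge0.
by apply: posD; exact: pos_sq.
Qed.

Lemma pos_swap x t : 0 <= t -> pos (t%:C%:A - star x * x) ->
  pos (t%:C%:A - x * star x).
Proof.
move=> t0 /pos_positive[_ sp].
have sx : selfadjoint (t%:C%:A - x * star x).
  apply: selfadjointB; first exact: selfadjoint_real.
  by rewrite /selfadjoint starM starK.
apply: positive_pos; split => // -[r i]; rewrite /spectrum /= inv_inT => h.
have [i0|i0] := eqVneq i 0; last by case: h; exact: sa_nonreal_inv.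
subst i; have [rt|rt] := ltrP r 0; last by rewrite lecE /= eqxx.
suff : spectrum (t%:C%:A - star x * x) (r%:C).
  by move=> /sp /=; rewrite lecE /= eqxx /= leNgt rt.
rewrite /spectrum /= inv_inT => hi; apply: h.
have tr : t - r != 0 by rewrite gt_eqF// subr_gt0 (lt_le_trans rt).
have n1 : -1 != 0 :> R by rewrite oppr_eq0 oner_eq0.
rewrite -[r +i* 0]/(r%:C).
rewrite (_ : _ - _ = (-1)%:C *: (x * star x - (t - r)%:C%:A)); last by nc_ring.
apply/(invZ _ n1); apply: (inv_swap tr); apply/(invZ _ n1).
have -> // : (-1)%:C *: (star x * x - (t - r)%:C%:A) = t%:C%:A - star x * x - r%:C%:A.
nc_ring.
Qed.

(** Approximate positive and negative parts, written with the square root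
    [s] of [a^2 + e^2] so that it is invertible: [s + a] is positive because
    [2 s (s + a) = (s + a)^2 + e^2]. *)
Lemma sa_split a (e : R) : selfadjoint a -> 0 < e -> exists s,
  [/\ pos (s + a), pos (s - a), s * s = a * a + (e ^+ 2)%:C%:A & s * a = a * s].
Proof.
move=> sa e0; have e20 : 0 < e ^+ 2 by rewrite exprn_gt0.
have pe : pos ((e ^+ 2)%:C%:A : A) by apply: pos_real; exact: ltW.
have pd : pos (a * a + (e ^+ 2)%:C%:A) by apply: posD => //; exact: pos_sq.
have [s [ps ss sc]] := pos_sqrt_comm pd.
have as_ : a * s = s * a by apply: sc; nc_ring.
have := pos_addr_inv (pos_sq sa) e20; rewrite -ss => iss.
have [s' [s1 s2]] : inv s by exact: (@inv_factor _ s).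
have ssa := pos_sa ps.
have ss' : selfadjoint s'.
  by rewrite /selfadjoint -[star s']mulr1 -s1 mulrA -{1}ssa -starM s1 star1 mul1r.
have ps' : pos s'.
  have sq : selfadjoint (s' * s') by exact: selfadjointM.
  rewrite (_ : s' = s * (s' * s')); last by rewrite mulrA s1 mul1r.
  apply: pos_mul_comm => //; first exact: pos_sq.
  by rewrite mulrA s1 mul1r -mulrA s2 mulr1.
suff key b : selfadjoint b -> b * s = s * b -> b * b = a * a -> pos (s + b).
  exists s; split=> //; first exact: key.
  by apply: key; [exact: selfadjointN|rewrite mulNr mulrN as_|rewrite mulrNN].
move=> sb bs bb.
have s'b : s' * b = b * s'.
  by rewrite -[LHS]mulr1 -s1 mulrA -(mulrA s' b) bs mulrA s2 mul1r.
have -> : s + b = 2^-1%:C *: (s' * ((s + b) * (s + b) + (e ^+ 2)%:C%:A)).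
  have -> : (s + b) * (s + b) + (e ^+ 2)%:C%:A = s * ((2 : R)%:C *: (s + b)).
    have -> : (s + b) * (s + b) = s * s + b * b + s * b + b * s by nc_ring.
    rewrite bs bb (_ : _ + (e ^+ 2)%:C%:A = s * s + (a * a + (e ^+ 2)%:C%:A) + (s * b + s * b)).
      by rewrite -ss; nc_ring.
    nc_ring.
  by rewrite mulrA s2 mul1r scaleVK ?pnatr_eq0.
apply: posZ; first by rewrite invr_ge0.
apply: pos_mul_comm => //.
  by apply: posD => //; apply: pos_sq; exact: selfadjointD.
have h : s' * (s + b) = (s + b) * s' by rewrite mulrDr mulrDl s1 s2 s'b.
rewrite [LHS]mulrDr [RHS]mulrDl -scalerAl -scalerAr mul1r mulr1; congr (_ + _).
by rewrite mulrA h -!mulrA h.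
Qed.

(** Let [n] be the negative part of [star x * x] and [y = x n].  Then
    [star y * y] is close to [- n^3], so [- star y * y] is almost positive;
    so is [- y * star y], which has the same nonzero spectrum.  As
    [star y * y + y * star y] is positive, [star y * y] is small, and so
    is [n]. *)
Lemma pos_starM x : pos (star x * x).
Proof.
set a := star x * x.
have sa : selfadjoint a by exact: selfadjoint_starM.
apply: pos_closed => e e0.
have [s [pa ma ss sc]] := sa_split sa e0.
pose h : R := 2^-1; have hh : h + h = 1 by rewrite /h; lra.
have h0 : 0 <= h by rewrite invr_ge0.
pose n := h%:C *: (s - a); pose m := h%:C *: (s + a).
have pn : pos n by exact: posZ.
have pm : pos m by exact: posZ.
have amn : a = m - n.
  by rewrite /m /n -scalerBr -[LHS]scale1r -[1]/(1%:C) -hh; nc_ring.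
pose c := h ^+ 2 * e ^+ 2.
have c0 : 0 <= c by rewrite mulr_ge0// exprn_ge0// ltW.
have mn : n * m = c%:C%:A.
  rewrite /m /n (_ : _ * _ = (h ^+ 2)%:C *: (s * s - a * a + (s * a - a * s))).
    by rewrite ss sc subrr addr0 addrC addKr scalerA -rmorphM.
  nc_ring.
have sn := pos_sa pn.
pose y := x * n.
have yy : star y * y = c%:C *: n - n * (n * n).
  rewrite /y starM sn mulrA -(mulrA n _ x) -/a amn mulrBr mulrBl mn -scalerAl mul1r.
  by rewrite mulrA.
pose k := c * cnorm n.
have k0 : 0 <= k by rewrite mulr_ge0 ?cnorm_ge0.
have nk : pos (k%:C%:A - c%:C *: n).
  by rewrite /k rmorphM -scalerA -scalerBr; apply: posZ => //; exact: ball_pos.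
have py : pos (k%:C%:A - star y * y).
  rewrite yy opprB addrA addrAC; apply: posD => //.
  by apply: pos_mul_comm => //; [exact: pos_sq|rewrite mulrA].
have py' : pos (k%:C%:A + star y * y).
  rewrite (_ : _ + _ = (k%:C%:A - y * star y) + (star y * y + y * star y)).
    by apply: posD; [exact: pos_swap|exact: pos_addstar].
  nc_ring.
have ny : cnorm (star y * y) <= k by exact: sa_norm_le.
have n3 : cnorm (n * (n * n)) <= 2 * k.
  rewrite (_ : n * _ = c%:C *: n - star y * y); last by rewrite yy subKr.
  rewrite (le_trans (cnormD _ _))// cnormN cnorm_real ger0_norm// -/k.
  by rewrite mulr_natl mulr2n lerD2l.
have n4 : cnorm n ^+ 4 <= cnorm n * (2 * k).
  rewrite (_ : _ ^+ 4 = cnorm (n * (n * (n * n)))).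
    by rewrite (le_trans (cnormM _ _))// ler_wpM2l ?cnorm_ge0.
  rewrite mulrA cnorm_sqr; last exact: selfadjointM.
  by rewrite cnorm_sqr// -exprM.
exists m => //; rewrite amn addrAC subrr add0r cnormN.
rewrite leNgt; apply/negP => en.
have n0 : 0 < cnorm n := lt_trans e0 en.
have e4 : cnorm n ^+ 4 = cnorm n ^+ 2 * cnorm n ^+ 2 by rewrite -exprD.
have e5 : cnorm n * (2 * k) = cnorm n ^+ 2 * (e ^+ 2 / 2) by rewrite /k /c /h; field.
move: n4; rewrite e4 e5.
have : 0 < cnorm n ^+ 2 by rewrite exprn_gt0.
have : e ^+ 2 < cnorm n ^+ 2 by rewrite ltr_pXn2r ?nnegrE ?ltW.
have : 0 < e ^+ 2 by rewrite exprn_gt0.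
nra.
Qed.

Lemma pos_Mstar x : pos (x * star x).
Proof. by rewrite -{1}[x]starK; exact: pos_starM. Qed.

Lemma pos_conj x d : pos d -> pos (star x * d * x).
Proof.
move=> /pos_sqrt[s [ps <- _]].
rewrite (_ : _ * _ * x = star (s * x) * (s * x)); first exact: pos_starM.
by rewrite starM (pos_sa ps) !mulrA.
Qed.

End Spectrum.

(** * Conditional expectations of finite index *)

Section Expectation.
Context {R : realType} {A : cstarType R} {P : set A} (E : cond_exp P).
Hypothesis P1 : P 1.
Implicit Types (x y z a p u v w : A) (t : R).

Lemma exp1 : E 1 = 1. Proof. exact: cexp_id. Qed.

Lemma expD x y : E (x + y) = E x + E y. Proof. exact: linearD. Qed.

Lemma expB x y : E (x - y) = E x - E y. Proof. exact: linearB. Qed.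

Lemma expZ (c : R[i]) x : E (c *: x) = c *: E x. Proof. exact: linearZ. Qed.

Lemma exp_sum I (r : seq I) (F : I -> A) :
  E (\sum_(i <- r) F i) = \sum_(i <- r) E (F i).
Proof. exact: linear_sum. Qed.

Lemma expK x : E (E x) = E x.
Proof. by apply: cexp_id; exact: cexp_range. Qed.

Lemma expMl x y : E (E x * y) = E x * E y.
Proof.
by have := cexp_bimod E y (cexp_range E x) P1; rewrite !mulr1.
Qed.

Lemma expMr x y : E (x * E y) = E x * E y.
Proof.
by have := cexp_bimod E x P1 (cexp_range E y); rewrite !mul1r.
Qed.

Lemma exp_fixM x y : E x = x -> E y = y -> E (x * y) = x * y.
Proof. by move=> ex ey; rewrite -{1}ex expMl ex ey. Qed.

Lemma exp_pos x : pos x -> pos (E x).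
Proof. by move=> px; apply/positive_pos/cexp_positive/pos_positive. Qed.

Lemma exp_sa x : selfadjoint x -> selfadjoint (E x).
Proof.
move=> sx.
have -> : E x = E ((cnorm x)%:C%:A + x) - (cnorm x)%:C%:A.
  by rewrite expD expZ exp1 addrC addKr.
apply: selfadjointB; last exact: selfadjoint_real.
by apply/pos_sa/exp_pos; exact: ball_posD.
Qed.

(** A self-adjoint element is a positive one minus a scalar, so [E] keeps it
    self-adjoint; then split [x] into real and imaginary parts. *)
Lemma exp_star x : E (star x) = star (E x).
Proof.
pose h := star x + x; pose k := 'i%C *: (star x - x).
have sh : selfadjoint h by rewrite /selfadjoint /h starD starK addrC.
have cji : conjc 'i%C = - 'i%C :> R[i].
  by apply/eqP; rewrite eq_complex /= oppr0 !eqxx.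
have sk : selfadjoint k.
  by rewrite /selfadjoint /k starZ starB starK -[X in _ *: X]opprB scalerN cji scaleNr opprK.
have hs := exp_sa sh; have ks := exp_sa sk.
have e1 : star (E (star x)) + star (E x) = E (star x) + E x.
  by move: hs; rewrite /selfadjoint /h expD starD.
have e2 : star (E (star x)) - star (E x) = E x - E (star x).
  move: ks; rewrite /selfadjoint /k expZ expB starZ starB cji scaleNr.
  move=> /(congr1 (fun y => 'i%C *: y)); rewrite scalerN !scalerA mulii !scaleN1r opprK.
  by rewrite opprB.
have n2 : 2 != 0 :> R by rewrite pnatr_eq0.
rewrite -[LHS](scaleVK _ n2) -[RHS](scaleVK _ n2); congr (_ *: _).
have -> : (2 : R)%:C *: E (star x) = (E (star x) + E x) - (E x - E (star x)) by nc_ring.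
by rewrite -e1 -e2; nc_ring.
Qed.

(** The difference is [E] of the square of [x - E x]. *)
Lemma exp_schwarz x : pos (E (star x * x) - star (E x) * E x).
Proof.
have -> : E (star x * x) - star (E x) * E x = E (star (x - E x) * (x - E x)).
  rewrite starB -exp_star.
  have -> : (star x - E (star x)) * (x - E x) = star x * x - star x * E x
      - (E (star x) * x - E (star x) * E x) by nc_ring.
  rewrite !expB expMr !expMl expK; nc_ring.
by apply: exp_pos; exact: pos_starM.
Qed.

Lemma exp_conj_le v x :
  pos ((cnorm v ^+ 2)%:C *: E (star x * x) - E (star (v * x) * (v * x))).
Proof.
rewrite -expZ -expB; apply: exp_pos.
have -> : (cnorm v ^+ 2)%:C *: (star x * x) - star (v * x) * (v * x) =
    star x * ((cnorm v ^+ 2)%:C%:A - star v * v) * x by rewrite starM; nc_ring.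
apply: pos_conj; apply: ball_pos; first exact: selfadjoint_starM.
by rewrite cnorm_starM.
Qed.

Lemma exp_schwarz_conj v x :
  pos ((cnorm v ^+ 2)%:C *: E (star x * x) - star (E (v * x)) * E (v * x)).
Proof.
rewrite -[_ - _](subrKA (E (star (v * x) * (v * x)))); apply: posD.
  exact: exp_conj_le.
exact: exp_schwarz.
Qed.

(** [E] maps an inverse in [A] to an inverse in [P]. *)
Lemma exp_inv x : E x = x -> inv x -> invertible_in P x.
Proof.
move=> ex [y [xy yx]]; exists (E y); first exact: cexp_range.
have e1 : x * E y = E (x * y) by rewrite -{2}ex expMl ex.
have e2 : E y * x = E (y * x) by rewrite -{2}ex expMr ex.
by rewrite e1 e2 xy yx exp1.
Qed.

Section QuasiBasis.
Context (s : seq (A * A)).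
Hypothesis qb : quasi_basis E s.

(** The Pimsner-Popa inequality, up to the value of the constant. *)
Lemma exp_norm_bound : exists2 K : R, 0 <= K &
  forall x, cnorm x ^+ 2 <= K * cnorm (E (star x * x)).
Proof.
pose k := \sum_(w <- s) cnorm w.1 * cnorm w.2.
have k0 : 0 <= k by apply: sumr_ge0 => w _; rewrite mulr_ge0 ?cnorm_ge0.
exists (k ^+ 2) => [|x]; first exact: exprn_ge0.
set D := cnorm (E _); have D0 : 0 <= D := cnorm_ge0 _.
have Dq : D = Num.sqrt D ^+ 2 by rewrite sqr_sqrtr.
rewrite [in leRHS]Dq -exprMn ler_pXn2r ?nnegrE ?cnorm_ge0 ?mulr_ge0 ?sqrtr_ge0//.
rewrite {1}(qb x).1 (le_trans (cnorm_sum _ _))// mulr_suml ler_sum// => w _.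
rewrite (le_trans (cnormM _ _))// -mulrA ler_wpM2l ?cnorm_ge0//.
rewrite -(@ler_pXn2r _ 2) ?nnegrE ?cnorm_ge0 ?mulr_ge0 ?sqrtr_ge0 ?cnorm_ge0//.
rewrite -cnorm_starM exprMn sqr_sqrtr//.
rewrite (le_trans (pos_le_norm (pos_starM _) (exp_schwarz_conj w.2 x)))//.
by rewrite cnorm_real ger0_norm ?exprn_ge0 ?cnorm_ge0.
Qed.

Lemma exp_faithful x : E (star x * x) = 0 -> x = 0.
Proof.
have [K K0 hK] := exp_norm_bound => h; apply: cnorm0_eq0.
have := hK x; rewrite h cnorm0 mulr0 => h2.
by apply/eqP; rewrite -sqrf_eq0 eq_le h2 exprn_ge0// cnorm_ge0.
Qed.

Lemma qb_starE x : x = \sum_(w <- s) star w.2 * E (star w.1 * x).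
Proof.
rewrite -[LHS]starK (qb (star x)).2 star_sum; apply: eq_bigr => w _.
by rewrite starM -exp_star starM starK.
Qed.

Section Trace.
Variable T : A -> A.
Hypothesis TD : {morph T : x y / x + y}.
Hypothesis TM : forall x y, T (x * E y) = T x * E y.
Hypothesis Tadj : forall x y, E (star (T x) * y) = E (star x * T y).
Hypothesis TT : forall x, T (T x) = T x.
Hypothesis Tbound : exists M : R, forall x, cnorm (T x) <= M * cnorm x.
Hypothesis Ttr : \sum_(w <- s) T w.1 * w.2 = 0.

Let TZ t x : T (t%:C *: x) = t%:C *: T x.
Proof.
have -> : t%:C *: x = x * E (t%:C%:A) by rewrite expZ exp1 -scalerAr mulr1.
by rewrite TM expZ exp1 -scalerAr mulr1.
Qed.
Let T0 : T 0 = 0.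
Proof. by rewrite -[0 in LHS](scale0r (0 : A)) (TZ 0) scale0r. Qed.
Let TN x : T (- x) = - T x.
Proof. by apply/eqP; rewrite -addr_eq0 -TD addrC subrr T0. Qed.
Let TB x y : T (x - y) = T x - T y.
Proof. by rewrite TD TN. Qed.
Let Tsum I (r : seq I) (F : I -> A) : T (\sum_(i <- r) F i) = \sum_(i <- r) T (F i).
Proof. exact: (big_morph _ TD T0). Qed.

Let W (w : A * A) := w.1 + star w.2.
Let S x := \sum_(w <- s) W w * E (star (W w) * x).

Let SD : {morph S : x y / x + y}.
Proof.
by move=> x y; rewrite /S -big_split; apply: eq_bigr => w _; rewrite mulrDr expD mulrDr.
Qed.
Let SM x y : S (x * E y) = S x * E y.
Proof.
by rewrite /S mulr_suml; apply: eq_bigr => w _; rewrite mulrA expMr mulrA.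
Qed.
Let SZ t x : S (t%:C *: x) = t%:C *: S x.
Proof.
by rewrite /S scaler_sumr; apply: eq_bigr => w _; rewrite -scalerAr expZ -scalerAr.
Qed.
Let Sip x y : E (star x * S y) = \sum_(w <- s) star (E (star (W w) * x)) * E (star (W w) * y).
Proof.
rewrite /S mulr_sumr exp_sum; apply: eq_bigr => w _.
by rewrite mulrA expMr -exp_star starM starK.
Qed.
Let Sadj x y : E (star (S x) * y) = E (star x * S y).
Proof.
rewrite -[LHS]starK -exp_star starM starK !Sip star_sum; apply: eq_bigr => w _.
by rewrite starM starK.
Qed.
Let Slow x : pos (E (star x * S x) - 2%:R%:C *: E (star x * x)).
Proof.
have -> : E (star x * S x) - 2%:R%:C *: E (star x * x) =
   \sum_(w <- s) (star (E (star w.1 * x)) * E (star w.1 * x)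
                + star (E (w.2 * x)) * E (w.2 * x)).
  have e : S x = x + x + \sum_(w <- s) (w.1 * E (star w.1 * x) + star w.2 * E (w.2 * x)).
    have : \sum_(w <- s) w.1 * E (w.2 * x) + \sum_(w <- s) star w.2 * E (star w.1 * x)
        + \sum_(w <- s) (w.1 * E (star w.1 * x) + star w.2 * E (w.2 * x)) = S x.
      rewrite /S -!big_split; apply: eq_bigr => w _ /=.
      by rewrite /W starD starK (mulrDl _ _ x) expD; nc_ring.
    by rewrite -(qb x).1 -(qb_starE x).
  rewrite e !mulrDr !expD mulr_sumr exp_sum.
  rewrite (_ : _ - _ = \sum_(w <- s) E (star x * (w.1 * E (star w.1 * x) + star w.2 * E (w.2 * x)))).
    apply: eq_bigr => w _; rewrite mulrDr expD !mulrA !expMr -!exp_star.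
    by rewrite !starM !starK.
  move: (\sum_(w <- s) _) => z; nc_ring.
by apply: pos_sum => w; apply: posD; exact: pos_starM.
Qed.
Let B := \sum_(w <- s) cnorm (W w) ^+ 2.
Let B0 : 0 <= B.
Proof. by apply: sumr_ge0 => w _; exact: exprn_ge0 (cnorm_ge0 _). Qed.
Let Shigh x : pos (B%:C *: E (star x * x) - E (star x * S x)).
Proof.
rewrite Sip /B rmorph_sum scaler_suml -sumrB; apply: pos_sum => w.
by rewrite -[cnorm _]cnorm_star; exact: exp_schwarz_conj.
Qed.

(* [3] exceeds the lower bound [2] of [S], which keeps [rho] positive. *)
Let C := B + 3.
Let C0 : 0 < C. Proof. by rewrite /C; have := B0; lra. Qed.
Let Cn0 : C != 0. Proof. by rewrite gt_eqF. Qed.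
Let Q x := x - C^-1%:C *: S x.
Let rho := 1 - 2 / C.
Let rho0 : 0 < rho.
Proof. by rewrite subr_gt0 ltr_pdivrMr// /C; have := B0; lra. Qed.
Let rho1 : rho < 1.
Proof. by rewrite gtrBl divr_gt0. Qed.

Let QD : {morph Q : x y / x + y}.
Proof. by move=> x y; rewrite /Q SD; nc_ring. Qed.
Let QM x y : Q (x * E y) = Q x * E y.
Proof. by rewrite /Q SM; nc_ring. Qed.
Let QZ t x : Q (t%:C *: x) = t%:C *: Q x.
Proof. by rewrite /Q SZ; nc_ring. Qed.
Let Q0 : Q 0 = 0.
Proof. by rewrite -[0 in LHS](scale0r (0 : A)) (QZ 0) scale0r. Qed.
Let QN x : Q (- x) = - Q x.
Proof. by apply/eqP; rewrite -addr_eq0 -QD addrC subrr Q0. Qed.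
Let QB x y : Q (x - y) = Q x - Q y.
Proof. by rewrite QD QN. Qed.
Let Qip x y : E (star x * Q y) = E (star x * y) - C^-1%:C *: E (star x * S y).
Proof. by rewrite /Q mulrBr expB -scalerAr expZ. Qed.
Let Qadj x y : E (star (Q x) * y) = E (star x * Q y).
Proof.
by rewrite Qip /Q starB mulrBl expB star_real -scalerAl expZ Sadj.
Qed.
Let Qpos x : pos (E (star x * Q x)).
Proof.
have -> : E (star x * Q x) = C^-1%:C *: (3%:C *: E (star x * x) + (B%:C *: E (star x * x) - E (star x * S x))).
  rewrite Qip -[X in X - _](scaleVK _ Cn0) -scalerBr; congr (_ *: _).
  by rewrite /C rmorphD; nc_ring.
apply: posZ; first by rewrite invr_ge0 ltW.
apply: posD; last exact: Shigh.
by apply: posZ => //; apply: exp_pos; exact: pos_starM.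
Qed.
Let Qrho x : pos (rho%:C *: E (star x * x) - E (star x * Q x)).
Proof.
have -> : rho%:C *: E (star x * x) - E (star x * Q x) =
   C^-1%:C *: (E (star x * S x) - 2%:R%:C *: E (star x * x)).
  by rewrite Qip /rho rmorphB rmorphM /=; nc_ring.
by apply: posZ; [rewrite invr_ge0 ltW|exact: Slow].
Qed.
(* [rho (rho Q - Q^2) = Q (rho - Q) Q + (rho - Q) Q (rho - Q)] *)
Let Qsq x : pos (rho%:C *: E (star x * Q x) - E (star (Q x) * Q x)).
Proof.
set y := rho%:C *: x - Q x.
have -> : rho%:C *: E (star x * Q x) - E (star (Q x) * Q x) =
   rho^-1%:C *: ((rho%:C *: E (star (Q x) * Q x) - E (star (Q x) * Q (Q x))) + E (star y * Q y)).
  have -> : E (star y * Q y) = rho%:C *: (rho%:C *: E (star x * Q x)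
      - 2%:R%:C *: E (star (Q x) * Q x)) + E (star (Q x) * Q (Q x)).
    rewrite /y QB QZ starB star_real.
    have -> : (rho%:C *: star x - star (Q x)) * (rho%:C *: Q x - Q (Q x)) =
      (rho%:C * rho%:C) *: (star x * Q x) - rho%:C *: (star x * Q (Q x))
      - rho%:C *: (star (Q x) * Q x) + star (Q x) * Q (Q x) by nc_ring.
    by rewrite expD !expB !expZ -[E (star x * Q (Q x))]Qadj; nc_ring.
  rewrite -[LHS](scaleVK _ (lt0r_neq0 rho0)); congr (_ *: _); nc_ring.
apply: posZ; first by rewrite invr_ge0 ltW.
by apply: posD.
Qed.

Let Qn n x := iter n Q x.
Let QnQ n x : Qn n (Q x) = Q (Qn n x). Proof. by elim: n => //= n ->. Qed.
Let QnA k n x : Qn (k + n) x = Qn k (Qn n x). Proof. exact: iterD. Qed.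
Let QnD n : {morph Qn n : x y / x + y}.
Proof. by move=> x y; elim: n => //= n ->; rewrite QD. Qed.
Let QnB n x y : Qn n (x - y) = Qn n x - Qn n y.
Proof. by elim: n => //= n ->; rewrite QB. Qed.
Let QnZ n t x : Qn n (t%:C *: x) = t%:C *: Qn n x.
Proof. by elim: n => //= n ->; rewrite QZ. Qed.
Let QnM n x y : Qn n (x * E y) = Qn n x * E y.
Proof. by elim: n => //= n ->; rewrite QM. Qed.
Let Qnadj n x y : E (star (Qn n x) * y) = E (star x * Qn n y).
Proof. by elim: n x y => //= n IH x y; rewrite Qadj IH QnQ. Qed.

Let Qcvg x : ccvg (Qn ^~ x) 0.
Proof.
have [K K0 hK] := exp_norm_bound.
have dec y : cnorm (E (star (Q y) * Q y)) <= rho ^+ 2 * cnorm (E (star y * y)).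
  have h1 := pos_le_norm (exp_pos (pos_starM (Q y))) (Qsq y).
  have h2 := pos_le_norm (Qpos y) (Qrho y).
  move: h1 h2; rewrite !cnorm_real !gtr0_norm// => h1 h2.
  by rewrite (le_trans h1)// expr2 -mulrA ler_pM2l.
have decn n : cnorm (E (star (Qn n x) * Qn n x)) <= rho ^+ (2 * n) * cnorm (E (star x * x)).
  elim: n => [|n IH]; first by rewrite muln0 expr0 mul1r.
  by rewrite (le_trans (dec _))// mulnS exprD -mulrA ler_wpM2l// exprn_ge0// ltW.
pose D := K * cnorm (E (star x * x)) + 1.
have D0 : 0 < D by rewrite ltr_wpDl// mulr_ge0// cnorm_ge0.
have bd n : cnorm (Qn n x) ^+ 2 <= D * (rho ^+ n) ^+ 2.
  rewrite (le_trans (hK _))// -exprM mulnC.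
  rewrite (le_trans (ler_wpM2l K0 (decn n)))// mulrCA mulrC ler_wpM2r ?exprn_ge0 ?(ltW rho0)//.
  by rewrite lerDl.
move=> e e0.
have : (rho ^+ n @[n --> \oo] --> 0)%R.
  by apply: cvg_expr; rewrite ger0_norm ?(ltW rho0).
have e1 : 0 < e / (D + 1) by rewrite divr_gt0// addr_gt0.
move=> /cvgr0Pnorm_lt /(_ _ e1)[N _ hN]; exists N => n /hN /=.
rewrite subr0 ger0_norm ?exprn_ge0 ?(ltW rho0)// => hn.
rewrite -(@ltr_pXn2r _ 2) ?nnegrE ?cnorm_ge0 ?(ltW e0)//.
rewrite (le_lt_trans (bd n))//.
have r0 : 0 <= rho ^+ n by rewrite exprn_ge0// ltW.
rewrite (@le_lt_trans _ _ ((D + 1) ^+ 2 * (rho ^+ n) ^+ 2))//.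
  by apply: ler_wpM2r; [exact: exprn_ge0|rewrite expr2; nra].
have D1 : 0 <= D + 1 by rewrite addr_ge0 ?(ltW D0).
rewrite -exprMn ltr_pXn2r ?nnegrE ?(ltW e0) ?(mulr_ge0 D1 r0)//.
by rewrite mulrC -ltr_pdivlMr// addr_gt0.
Qed.

Let m (X : A -> A) := \sum_(w <- s) X w.1 * w.2.

(* [X] composed with [S] and with the adjoint [Y] of [X] has nonnegative
   trace, because the trace of a rank one operator [x <x, _>] is [x x^*]. *)
Let m_S (X Y : A -> A) : {morph X : x y / x + y} -> X 0 = 0 ->
  (forall x y, X (x * E y) = X x * E y) ->
  (forall x y, E (star (X x) * y) = E (star x * Y y)) ->
  m (fun x => X (S (Y x))) = \sum_(w <- s) X (W w) * star (X (W w)).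
Proof.
move=> XD X0 XM XY.
under [RHS]eq_bigr => w _ do rewrite [star (X (W w))](qb _).2 mulr_sumr.
rewrite exchange_big; apply: eq_bigr => w _ /=.
rewrite /S (big_morph X XD X0) mulr_suml; apply: eq_bigr => w' _.
by rewrite XM XY mulrA.
Qed.

Lemma trace0_eq0 x : T x = 0.
Proof.
have [M hM] := Tbound.
have Tcvg (u : nat -> A) : ccvg u 0 -> ccvg (fun n => T (u n)) 0.
  move=> u0 e e0.
  have M1 : 0 < `|M| + 1 by rewrite ltr_wpDl.
  have [|N hN] := u0 (e / (`|M| + 1)); first by rewrite divr_gt0.
  exists N => n /hN; rewrite !subr0 ltr_pdivlMr// => h.
  rewrite (le_lt_trans (hM _))// (le_lt_trans _ h)// mulrC ler_wpM2l ?cnorm_ge0//.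
  by rewrite (le_trans (ler_norm _))// lerDl.
have cvgMr (u : nat -> A) v : ccvg u 0 -> ccvg (fun n => u n * v) 0.
  by move=> u0; rewrite -(mul0r v); apply: (ccvgM u0); exact: ccvg_cst.
pose G y := y + Q y.
have QS y : C^-1%:C *: S y = y - Q y by rewrite /Q subKr.
have mB X Y : m (fun y => X y - Y y) = m X - m Y.
  by rewrite /m -sumrB; apply: eq_bigr => w _; rewrite mulrBl.
have mD X Y : m (fun y => X y + Y y) = m X + m Y.
  by rewrite /m -big_split; apply: eq_bigr => w _; rewrite mulrDl.
have mZ t X : m (fun y => t%:C *: X y) = t%:C *: m X.
  by rewrite /m scaler_sumr; apply: eq_bigr => w _; rewrite -scalerAl.
have meq X Y : X =1 Y -> m X = m Y.
  by move=> XY; rewrite /m; apply: eq_bigr => w _; rewrite XY.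
have Ci0 : 0 <= C^-1 by rewrite invr_ge0 ltW.
pose X k y := T (G (Qn k y)); pose Y k y := Qn k (G (T y)).
have pX k : pos (C^-1%:C *: m (fun y => X k (S (Y k y)))).
  apply: posZ => //; rewrite m_S.
  - by apply: pos_sum => w; exact: pos_Mstar.
  - by move=> y z; rewrite /X /G QnD QD -TD; congr T; rewrite addrACA.
  - rewrite /X /G; suff -> : Qn k 0 = 0 by rewrite Q0 addr0 T0.
    by elim: k => //= k ->; rewrite Q0.
  - by move=> y z; rewrite /X /G QnM QM -mulrDl TM.
  - move=> y z; rewrite /X /Y /G Tadj starD mulrDl expD Qadj -expD -mulrDr.
    by rewrite Qnadj.
have step k : m (fun y => T (Qn (2 * k) (G (T y)))) =
    C^-1%:C *: m (fun y => X k (S (Y k y))) + m (fun y => T (Qn (2 * k.+1) (G (T y)))).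
  rewrite -mZ -mD; apply: meq => y; rewrite /X /Y.
  set z := G (T y).
  have -> : C^-1%:C *: T (G (Qn k (S (Qn k z)))) = T (G (Qn k (C^-1%:C *: S (Qn k z)))).
    by rewrite QnZ /G QZ -scalerDr TZ.
  rewrite QS QnB -TD; congr T; rewrite /G QB QnQ.
  by rewrite !mul2n doubleS -addnn /= -/(Qn _ _) QnA; nc_ring.
have pG : pos (m (fun y => T (G (T y)))).
  pose p n := \sum_(k < n) C^-1%:C *: m (fun y => X k (S (Y k y))).
  have eN n : m (fun y => T (G (T y))) = p n + m (fun y => T (Qn (2 * n) (G (T y)))).
    elim: n => [|n ->]; first by rewrite /p big_ord0 add0r.
    by rewrite step /p big_ord_recr /= addrA.
  have c0 : ccvg (fun n => m (fun y => T (Qn n (G (T y))))) 0.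
    by apply: ccvg_sum => w; apply: cvgMr; apply: Tcvg; exact: Qcvg.
  apply: pos_closed => e /c0[N hN]; exists (p N).
    by apply: pos_sum => k; exact: pX.
  rewrite {1}(eN N) addrC addKr ltW//; rewrite -[m _]subr0; apply: hN.
  by rewrite mul2n -addnn leq_addr.
have pS : pos (C^-1%:C *: m (fun y => T (S (T y)))).
  by apply: posZ => //; rewrite m_S//; apply: pos_sum => w; exact: pos_Mstar.
have sum0 : C^-1%:C *: m (fun y => T (S (T y))) + m (fun y => T (G (T y))) = 0.
  rewrite -mZ -mD.
  have -> : m (fun y => C^-1%:C *: T (S (T y)) + T (G (T y))) = m (fun y => T y + T y).
    apply: meq => y; transitivity (T (T y + T y)); last by rewrite TD !TT.
    by rewrite -TZ -[LHS]TD QS; congr (T _); rewrite /G; nc_ring.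
  by rewrite mD /m Ttr addr0.
have mS0 : m (fun y => T (S (T y))) = 0.
  have h : C^-1%:C *: m (fun y => T (S (T y))) = 0.
    apply: pos_antisym => //.
    suff -> : - (C^-1%:C *: m (fun y => T (S (T y)))) = m (fun y => T (G (T y))) by [].
    by apply/eqP; rewrite eq_sym -addr_eq0 addrC sum0.
  by rewrite -[LHS](scaleKV _ Cn0) h scaler0.
have TW y : T (S y) = 0.
  move: mS0; rewrite m_S// => h.
  have := pos_sum_eq0 (fun w : A * A => pos_Mstar (T (W w))) h => {}h.
  rewrite /S Tsum big1_seq// => w /andP[_ /h h1]; rewrite TM.
  suff -> : T (W w) = 0 by rewrite mul0r.
  by apply: (can_inj (@starK _ A)); rewrite star0; apply: cnorm0_eq0; apply/eqP;
     rewrite -sqrf_eq0 -cnorm_starM starK h1 cnorm0.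
have TQ y : T (Q y) = T y by rewrite /Q TB TZ TW scaler0 subr0.
have TQn n : T (Qn n x) = T x by elim: n => //= n <-; rewrite TQ.
apply: (@ccvg_unique _ _ (fun=> T x)); first exact: ccvg_cst.
exact: eq_ccvg (Tcvg _ (Qcvg x)).
Qed.

End Trace.
End QuasiBasis.
End Expectation.

(** * Rokhlin projections *)

Section RokhlinProjection.
Context {R : realType} {A : cstarType R} {P : set A} (E : cond_exp P).
Hypothesis P1 : P 1.
Context (s : seq (A * A)).
Hypothesis qb : quasi_basis E s.
Context (lam : R).
Hypothesis index_lam : \sum_(w <- s) w.1 * w.2 = lam%:C%:A.
Implicit Types (x y a p u v : A).

(** The index is the trace of the identity operator. *)
Lemma index_neq0 : lam != 0.
Proof.
apply/eqP => l0; have /eqP : (1 : A) = 0; last by rewrite oner_eq0.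
apply: (@trace0_eq0 R A P E P1 s qb id) => //.
- by exists 1 => x; rewrite mul1r.
- by rewrite index_lam l0 scale0r.
Qed.

Context (e : A).
Hypothesis pe : projection e.
Let g := lam%:C *: E e.
Hypothesis pg : projection g.
Let se : star e = e := pe.1.
Let ee : e * e = e := pe.2.
Let Eg : E g = g.
Proof. by rewrite /g expZ expK. Qed.
Let E1g : E (1 - g) = 1 - g.
Proof. by rewrite expB Eg exp1. Qed.

(** [E] maps [(1 - g) e (1 - g)] to a multiple of [(1 - g) g (1 - g) = 0], and it
    is faithful. *)
Lemma rokhlin_eg : e * g = e.
Proof.
have e0 : e * (1 - g) = 0.
  apply: (exp_faithful P1 qb).
  have -> : star (e * (1 - g)) * (e * (1 - g)) = E (1 - g) * (e * E (1 - g)).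
    by rewrite E1g starM starB star1 pg.1 se mulrA -(mulrA _ e e) ee -mulrA.
  rewrite expMl// expMr// E1g.
  rewrite -[LHS](scaleVK _ index_neq0) scalerAr [lam%:C *: (_ * _)]scalerAl -/g.
  by rewrite [g * _]mulrBr mulr1 pg.2 subrr mulr0 ?scaler0.
by apply/eqP; rewrite eq_sym -subr_eq0 -{1}[e]mulr1 -mulrBr e0.
Qed.

(** The operator [y |-> lam e E(e y)] is [lam e e_P e] for the Jones
    projection [e_P].  It is a projection below [e], with the same trace, so it
    is [e]. *)
Lemma rokhlin_left y : e * y = lam%:C *: (e * E (e * y)).
Proof.
pose T y := e * y - lam%:C *: (e * E (e * y)).
suff : T y = 0 by move=> /eqP; rewrite subr_eq0 => /eqP.
apply: (trace0_eq0 P1 qb) => {y}.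
- by move=> x y; rewrite /T mulrDr expD; nc_ring.
- by move=> x y; rewrite /T mulrA expMr// ; nc_ring.
- move=> x y; rewrite /T starB star_real !starM se -exp_star// starM se.
  rewrite mulrBl mulrBr !expB -!scalerAl -!scalerAr !expZ -!mulrA expMl//.
  by rewrite !mulrA expMr// !mulrA.
- move=> y; rewrite /T; set z := e * y.
  have ez : e * z = z by rewrite /z mulrA ee.
  have e1 : e * (z - lam%:C *: (e * E z)) = z - lam%:C *: (e * E z).
    by rewrite mulrBr ez -scalerAr mulrA ee.
  rewrite e1 expB expZ expMr// (_ : lam%:C *: (E e * E z) = g * E z); last by rewrite -scalerAl.
  by rewrite mulrBr mulrA rokhlin_eg subrr scaler0 subr0.
- exists (cnorm e + `|lam| * (cnorm e * cnorm e)) => y.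
  rewrite /T (le_trans (cnormD _ _))// cnormN cnorm_real mulrDl lerD ?cnormM//.
  rewrite -!mulrA ler_wpM2l// (le_trans (cnormM _ _))// ler_wpM2l ?cnorm_ge0//.
  by rewrite (le_trans (cexp_contractive E _))// cnormM.
- rewrite /T; under eq_bigr => w _ do rewrite mulrBl -scalerAl -!mulrA.
  by rewrite sumrB -mulr_sumr index_lam -scaler_sumr -mulr_sumr -(qb e).2 ee
     -scalerAr mulr1 subrr.
Qed.

Definition phi a : A := lam%:C *: E (e * a).

Lemma phi_exp a : E (phi a) = phi a.
Proof. by rewrite /phi expZ expK. Qed.

Lemma phiB a b : phi (a - b) = phi a - phi b.
Proof. by rewrite /phi mulrBr expB scalerBr. Qed.

Lemma rokhlin_right a : a * e = e * a -> phi a * e = a * e.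
Proof.
move=> ae; have := congr1 star (rokhlin_left (star a)).
rewrite star_real !starM starK se -exp_star// starM starK se -scalerAl -/(phi _).
by rewrite /phi -ae scalerAl.
Qed.

(** The left factor [phi a] moves inside [E], next to [e], where [phi a * e]
    is [a * e]. *)
Lemma phiM a b : a * e = e * a -> phi a * phi b = phi (a * b).
Proof.
move=> ae; rewrite {2}/phi -scalerAr -{1}(phi_exp a) -expMl// phi_exp.
by rewrite mulrA rokhlin_right// ae /phi mulrA.
Qed.

Lemma phi_star a : a * e = e * a -> star (phi a) = phi (star a).
Proof.
move=> ae; rewrite /phi star_real -exp_star// starM se; congr (_ *: E _).
by rewrite -[in LHS]se -starM -ae starM se.
Qed.

Lemma phi_fix p : E p = p -> phi p = g * p.
Proof. by move=> Ep; rewrite /phi -Ep expMr// -scalerAl Ep. Qed.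

Lemma rokhlin_commute p : p * e = e * p -> E p = p -> p * g = g * p.
Proof.
move=> pc Ep; rewrite -(phi_fix Ep) /phi -pc -{2}Ep expMl// Ep.
by rewrite -scalerAr.
Qed.

Lemma phi_norm a : cnorm (phi a) <= `|lam| * cnorm a.
Proof.
rewrite /phi cnorm_real ler_wpM2l// (le_trans (cexp_contractive E _))//.
rewrite (le_trans (cnormM _ _))// ler_piMl ?cnorm_ge0//.
have : cnorm e ^+ 2 = cnorm e by rewrite -cnorm_starM se ee.
by have := cnorm_ge0 e; nra.
Qed.

Lemma phi_eq0 a : a * e = e * a -> phi (star a * a) = 0 -> a * e = 0.
Proof.
move=> ae h; apply: (exp_faithful P1 qb).
have ea : e * star a = star a * e by rewrite -{1}se -starM ae starM se.
rewrite starM se (_ : e * star a * (a * e) = e * (star a * a)).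
  by rewrite -[LHS](scaleVK _ index_neq0) -/(phi _) h scaler0.
by rewrite ae ea mulrA -(mulrA _ e e) ee -ea mulrA.
Qed.

Lemma index_gt0 : e <> 0 -> 0 < lam.
Proof.
move=> e0; rewrite lt_neqAle eq_sym index_neq0 leNgt /=; apply/negP => l0.
have pE : pos (E e) by apply: exp_pos => //; rewrite -ee; exact: pos_sq.
have g0 : g = 0.
  apply: pos_antisym; first by rewrite -pg.2; apply: pos_sq; exact: pg.1.
  rewrite /g -scaleNr -rmorphN; apply: posZ => //.
  by rewrite oppr_ge0 ltW.
apply: e0; apply: (exp_faithful P1 qb); rewrite se ee.
by rewrite -[LHS](scaleVK _ index_neq0) -/g g0 scaler0.
Qed.

(** By [rokhlin_left], [v = lam e E(v)], so that [star v * v] is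
    [lam star v * E v]: the range of [v] lying under [e] is what makes [E v] as
    good as [v]. *)
Lemma rokhlin_transfer v : 0 < lam -> e * v = v ->
  let w := (Num.sqrt lam)%:C *: E v in star w * w = E (star v * v).
Proof.
move=> l0 ev w; rewrite /w star_real -scalerAl -scalerAr scalerA -rmorphM /=.
rewrite -expr2 sqr_sqrtr ?ltW//.
have h := rokhlin_left v; rewrite ev in h.
have -> : star v * v = lam%:C *: (star v * E v).
  by rewrite {2}h -scalerAr mulrA -{1}se -starM ev.
by rewrite expZ expMr// exp_star.
Qed.

End RokhlinProjection.

(** * The sequence algebra and the induced expectation *)

Section SequenceAlgebra.
Context {R : realType} {A : cstarType R}.
Implicit Types (x y : A) (u v : linf A).

Lemma star_cls u : star (cls u) = cls (linf_star u).
Proof. by rewrite cls_star. Qed.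

Lemma cls_ext u v : (forall n, u n = v n) -> cls u = cls v.
Proof. by move=> h; congr cls; apply/val_inj/funext. Qed.

Lemma constD x y : const_inf (x + y) = const_inf x + const_inf y.
Proof. by rewrite /const_inf -raddfD; exact: cls_ext. Qed.

Lemma constB x y : const_inf (x - y) = const_inf x - const_inf y.
Proof. by rewrite /const_inf -raddfB; exact: cls_ext. Qed.

Lemma const0 : const_inf (0 : A) = 0.
Proof. by rewrite -[X in const_inf X](subrr 0) constB subrr. Qed.

Lemma constM x y : const_inf (x * y) = const_inf x * const_inf y.
Proof. by rewrite /const_inf -cls_mul; exact: cls_ext. Qed.

Lemma constZ (c : R[i]) x : const_inf (c *: x) = c *: const_inf x.
Proof. by rewrite /const_inf -cls_scale; exact: cls_ext. Qed.

Lemma const1 : const_inf (1 : A) = 1.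
Proof. exact: cls_ext. Qed.

Lemma const_star x : const_inf (star x) = star (const_inf x).
Proof. by rewrite star_cls; exact: cls_ext. Qed.

Lemma const_sum I (r : seq I) (F : I -> A) :
  const_inf (\sum_(i <- r) F i) = \sum_(i <- r) const_inf (F i).
Proof. exact: (big_morph _ constD const0). Qed.

Lemma const_norm x : cnorm (const_inf x) <= cnorm x.
Proof.
apply: (Ainf_norm_le (Linf (cst_linf_subproof x)) _).2 => e e0.
by apply: nearW => n; rewrite /= lerDl ltW.
Qed.

Lemma const_projection x : projection x -> projection (const_inf x).
Proof.
by move=> [h1 h2]; split; [rewrite /selfadjoint -const_star h1|rewrite -constM h2].
Qed.

Lemma linf_sumE I (r : seq I) (F : I -> linf A) n :
  (\sum_(i <- r) F i) n = \sum_(i <- r) F i n.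
Proof.
elim: r => [|i r IH]; first by rewrite !big_nil.
by rewrite !big_cons -IH.
Qed.

Lemma cls_norm_near u (c : R) : cnorm (cls u) < c ->
  \forall n \near \oo, cnorm (u n) < c.
Proof.
move=> h; have d0 : 0 < (c - cnorm (cls u)) / 2 by rewrite divr_gt0// subr_gt0.
near=> n; apply: (@le_lt_trans _ _ (cnorm (cls u) + (c - cnorm (cls u)) / 2)).
  by near: n; exact: Ainf_norm_near.
lra.
Unshelve. all: by end_near. Qed.

End SequenceAlgebra.

Section SequenceExpectation.
Context {R : realType} {A : cstarType R} {P : set A} (E : cond_exp P).
Hypothesis P1 : P 1.
Implicit Types (x y : A) (X Y : Ainf A).

Lemma Einf_const x : Einf E (const_inf x) = const_inf (E x).
Proof. by rewrite Einf_cls; exact: cls_ext. Qed.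

Lemma Einf_linear : linear (Einf E).
Proof.
move=> c X Y; rewrite -(clsK X) -(clsK Y) -cls_scale -raddfD !Einf_cls.
rewrite -cls_scale -raddfD; apply: cls_ext => n /=.
by rewrite [LHS]linearD [X in X + _]linearZ.
Qed.

HB.instance Definition _ :=
  GRing.isLinear.Build R[i] (Ainf A) (Ainf A) *:%R (Einf E) Einf_linear.

Lemma Einf_id X : @Pinf R A P X -> Einf E X = X.
Proof.
move=> [u Pu <-]; rewrite Einf_cls; apply: cls_ext => n /=.
exact: cexp_id.
Qed.

Lemma Einf_bimod X Y Z : @Pinf R A P X -> @Pinf R A P Z ->
  Einf E (X * Y * Z) = X * Einf E Y * Z.
Proof.
move=> [u Pu <-] [w Pw <-]; rewrite -(clsK Y) Einf_cls -!cls_mul Einf_cls.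
by apply: cls_ext => n /=; exact: cexp_bimod.
Qed.

Lemma Einf_contractive X : cnorm (Einf E X) <= cnorm X.
Proof.
rewrite -(clsK X) Einf_cls; apply: (Ainf_norm_le _ _).2 => e e0.
near=> n; rewrite (le_trans (cexp_contractive E _))//.
by near: n; exact: Ainf_norm_near.
Unshelve. all: by end_near. Qed.

Lemma Einf_star X : Einf E (star X) = star (Einf E X).
Proof.
rewrite -(clsK X) star_cls !Einf_cls star_cls; apply: cls_ext => n /=.
exact: exp_star.
Qed.

(** Unital self-adjoint contractions preserve the balls that define [pos]. *)
Lemma Einf_positive X : positive X -> positive (Einf E X).
Proof.
move=> /positive_pos[sX [t t0 tX]]; apply: pos_positive; split.
  by rewrite /selfadjoint -Einf_star sX.
exists t => //; rewrite (le_trans _ tX)// -[X in X - _](_ : Einf E (t%:C%:A) = _).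
  by rewrite -linearB; exact: Einf_contractive.
by rewrite linearZ /= -const1 Einf_const exp1.
Qed.

Definition Einf_exp : cond_exp (@Pinf R A P) :=
  @CondExp R (Ainf A) (@Pinf R A P) (Einf E) (Einf_range E) Einf_id Einf_bimod
    Einf_positive Einf_contractive.

Lemma Einf_expE X : Einf_exp X = Einf E X. Proof. by []. Qed.

Lemma Pinf1 : @Pinf R A P 1.
Proof. by rewrite -const1; exists (Linf (cst_linf_subproof 1)). Qed.

Lemma Einf_quasi_basis s : quasi_basis E s ->
  quasi_basis Einf_exp [seq (const_inf w.1, const_inf w.2) | w <- s].
Proof.
move=> qb X; rewrite !big_map -(clsK X); set u := repr X.
pose c x := Linf (cst_linf_subproof x).
have sumE (F : A * A -> linf A) (G : A * A -> Ainf A) : (forall w, G w = cls (F w)) ->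
    (forall n, u n = \sum_(w <- s) F w n) -> cls u = \sum_(w <- s) G w.
  move=> GF uF; under eq_bigr => w _ do rewrite GF.
  by rewrite -raddf_sum; apply: cls_ext => n; rewrite linf_sumE.
split.
  apply: (sumE (fun w => c w.1 * cexp_linf E (c w.2 * u))) => [w|n].
    by rewrite cls_mul -Einf_cls cls_mul.
  exact: (qb (u n)).1.
apply: (sumE (fun w => cexp_linf E (u * c w.1) * c w.2)) => [w|n].
  by rewrite cls_mul -Einf_cls cls_mul.
exact: (qb (u n)).2.
Qed.

(** Averaging a representative with its adjoint and applying [E] entrywise does
    not change the class. *)
Lemma Pinf_repr X : selfadjoint X -> Einf E X = X ->
  exists u : linf A, [/\ cls u = X, forall n, selfadjoint (u n) & forall n, E (u n) = u n].
Proof.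
move=> sX EX.
exists (cexp_linf E (2^-1%:C *: (repr X + linf_star (repr X)))); split.
- rewrite -Einf_cls cls_scale raddfD /= -star_cls clsK sX linearZ linearD /= EX.
  by rewrite -[RHS](scaleVK _ (_ : 2 != 0 :> R)) ?pnatr_eq0//; nc_ring.
- move=> n; rewrite /selfadjoint /= -exp_star// star_real starD starK.
  by congr (E (_ *: _)); exact: addrC.
- by move=> n; rewrite /= expK.
Qed.

(** Entries of a representative of [X^-1] far along the sequence are almost
    inverses of the entries of [X], which is enough for the latter to be
    invertible in [A], hence in [P]. *)
Lemma Pinf_lift X (x : A) (e : R) :
  selfadjoint X -> inv X -> Einf E X = X -> cnorm (const_inf x - X) < e ->
  exists y, [/\ P y, selfadjoint y, invertible_in P y & cnorm (x - y) < e].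
Proof.
move=> sX [Z [XZ ZX]] EX Xe.
have [u [uX su Eu]] := Pinf_repr sX EX.
have uZ : cls (1 - u * repr Z) = 0 by rewrite raddfB /= cls_mul uX clsK XZ subrr.
have Zu : cls (1 - repr Z * u) = 0 by rewrite raddfB /= cls_mul uX clsK ZX subrr.
have h1 : \forall n \near \oo, cnorm (1 - u n * repr Z n) < 1.
  by apply: (@cls_norm_near _ _ (1 - u * repr Z)); rewrite uZ cnorm0.
have h2 : \forall n \near \oo, cnorm (1 - repr Z n * u n) < 1.
  by apply: (@cls_norm_near _ _ (1 - repr Z * u)); rewrite Zu cnorm0.
have h3 : \forall n \near \oo, cnorm (x - u n) < e.
  apply: (@cls_norm_near _ _ (Linf (cst_linf_subproof x) - u)).
  by rewrite raddfB /= uX.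
have [N _ hN] : \forall n \near \oo, cnorm (1 - u n * repr Z n) < 1 /\
    cnorm (1 - repr Z n * u n) < 1 /\ cnorm (x - u n) < e.
  by near=> n; split; [|split]; near: n.
have [/= k1 [k2 k3]] := hN N (leqnn N).
exists (u N); split => //; first by rewrite -Eu; exact: cexp_range.
apply: (exp_inv P1 (Eu N)); apply: (@inv_factor _ _ _ (repr Z N)); exact: inv_near1.
Unshelve. all: by end_near. Qed.

End SequenceExpectation.

(** * Projections and real rank zero *)

Section Projections.
Context {R : realType} {A : cstarType R}.
Implicit Types (x y a b c d p q r s z : A) (t : R).

Lemma proj_norm p : projection p -> cnorm p <= 1.
Proof.
move=> [sp pp]; have : cnorm p ^+ 2 = cnorm p by rewrite -cnorm_starM sp pp.
by have := cnorm_ge0 p; nra.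
Qed.

Lemma projC p : projection p -> projection (1 - p).
Proof.
move=> [sp pp]; split; first by apply: selfadjointB => //; exact: star1.
by rewrite mulrBl mul1r mulrBr mulr1 pp subrr subr0.
Qed.

Lemma proj_pos p : projection p -> pos p.
Proof. by move=> [sp pp]; rewrite -pp; exact: pos_sq. Qed.

Lemma projM p q : projection p -> projection q -> p * q = q * p ->
  projection (p * q).
Proof.
move=> [sp pp] [sq qq] pq; split; first exact: selfadjointM.
by rewrite mulrA -(mulrA p q p) -pq mulrA pp -mulrA qq.
Qed.

Lemma cnorm_Mproj x p : projection p -> cnorm (x * p) <= cnorm x.
Proof.
move=> /proj_norm h; rewrite (le_trans (cnormM _ _))//.
by rewrite ler_piMr ?cnorm_ge0.
Qed.

Lemma cnorm_projM x p : projection p -> cnorm (p * x) <= cnorm x.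
Proof.
move=> /proj_norm h; rewrite (le_trans (cnormM _ _))//.
by rewrite ler_piMl ?cnorm_ge0.
Qed.

Lemma starM_eq0 x : star x * x = 0 -> x = 0.
Proof.
by move=> h; apply: cnorm0_eq0; apply/eqP; rewrite -sqrf_eq0 -cnorm_starM h cnorm0.
Qed.

Lemma inv_sa x y : selfadjoint x -> x * y = 1 -> selfadjoint y.
Proof.
move=> sx xy; have yx : star y * x = 1 by rewrite -{1}sx -starM xy star1.
by rewrite /selfadjoint -[LHS]mulr1 -xy mulrA yx mul1r.
Qed.

Lemma inv_comm x y c : x * y = 1 -> y * x = 1 -> c * x = x * c -> c * y = y * c.
Proof.
move=> xy yx cx.
by rewrite -[LHS]mul1r -yx -mulrA (mulrA x) -cx -!mulrA xy mulr1.
Qed.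

Lemma pisometry v p : projection p -> star v * v = p -> v * p = v.
Proof.
move=> [sp pp] vv; apply/eqP; rewrite eq_sym -subr_eq0; apply/eqP/starM_eq0.
rewrite starB starM sp.
have -> : (star v - p * star v) * (v - v * p) =
  star v * v - star v * v * p - p * (star v * v) + p * (star v * v) * p by nc_ring.
by rewrite vv !pp subrr sub0r addNr.
Qed.

(** If [0 <= x <= y] and [1 - z] kills [y], then it kills the square root of
    [x]. *)
Lemma hereditary_corner z : projection z ->
  hereditary [set x | z * x = x /\ x * z = x].
Proof.
move=> pz; have [sz zz] := pz; split; last first.
  move=> x y /= [zy yz] /positive_pos px /positive_pos pyx.
  have [pc _] := projC pz.
  have sx := pos_sa px.
  have pcx : pos ((1 - z) * x * (1 - z)) by rewrite -{1}pc; exact: pos_conj.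
  have cx0 : (1 - z) * x * (1 - z) = 0.
    apply: pos_antisym => //.
    rewrite (_ : - _ = star (1 - z) * (y - x) * (1 - z)); first exact: pos_conj.
    rewrite pc [(1 - z) * (y - x)]mulrBr (_ : (1 - z) * y = 0) ?sub0r ?mulNr//.
    by rewrite mulrBl mul1r zy subrr.
  have [s [ps ss _]] := pos_sqrt px.
  have sc0 : s * (1 - z) = 0.
    by apply: starM_eq0; rewrite starM pc (pos_sa ps) mulrA -(mulrA _ s s) ss.
  have xz : x * z = x.
    apply/eqP; rewrite eq_sym -subr_eq0 -{1}[x]mulr1 -mulrBr -ss -mulrA sc0.
    by rewrite mulr0.
  by split=> //; have := congr1 star xz; rewrite starM sz sx.
split.
- by rewrite /= mulr0 mul0r.
- by move=> x y /= [h1 h2] [h3 h4]; rewrite mulrDr mulrDl h1 h2 h3 h4.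
- by move=> c x /= [h1 h2]; rewrite -scalerAr -scalerAl h1 h2.
- by move=> x y /= [h1 h2] [h3 h4]; rewrite mulrA h1 -mulrA h4.
- by move=> x /= [h1 h2]; split; rewrite -{1}sz -starM ?h1 ?h2.
- have norm_bound x y (e : R) : cnorm (x - y) < e / 2 -> z * y = y -> y * z = y ->
      cnorm (z * x - x) <= e /\ cnorm (x * z - x) <= e.
    move=> h h1 h2.
    have e1 : z * x - x = z * (x - y) - (x - y) by rewrite mulrBr h1; nc_ring.
    have e2 : x * z - x = (x - y) * z - (x - y) by rewrite mulrBl h2; nc_ring.
    have k1 := cnorm_projM (x - y) pz; have k2 := cnorm_Mproj (x - y) pz.
    rewrite e1 e2; split; rewrite (le_trans (cnormD _ _))// cnormN; lra.
  move=> x h; split; apply/eqP; rewrite -subr_eq0; apply/eqP/cnorm_eq0P => e e0.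
    have [|y [h1 h2] /norm_bound k] := h (e / 2); first by rewrite divr_gt0.
    by have [] := k h1 h2.
  have [|y [h1 h2] /norm_bound k] := h (e / 2); first by rewrite divr_gt0.
  by have [] := k h1 h2.
Qed.

Lemma hereditary_generated_proj z q : projection z -> hereditary_generated z q ->
  z * q = q.
Proof.
move=> pz h; have [_ zz] := pz.
by have [] := h _ (hereditary_corner pz) (conj zz zz).
Qed.

(** [b s^-1] is the sign of [b]. *)
Lemma sign_projection b s s' : selfadjoint b -> selfadjoint s -> s * s = b * b ->
  b * s = s * b -> s * s' = 1 -> s' * s = 1 ->
  let r := 2^-1%:C *: (1 + b * s') in projection r /\ r * b = r * s.
Proof.
move=> sb ss bb bs s1 s2 r.
have n2 : 2 != 0 :> R by rewrite pnatr_eq0.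
have bs' : b * s' = s' * b by apply: inv_comm s1 s2 bs.
have ss' : selfadjoint s' := inv_sa ss s1.
pose f := b * s'.
have ff : f * f = 1.
  by rewrite /f mulrA -(mulrA b s' b) -bs' mulrA -bb -(mulrA s s) s1 mulr1 s1.
have fs : f * s = b by rewrite /f -mulrA s2 mulr1.
have fb : f * b = s by rewrite -{1}fs mulrA ff mul1r.
have sf : selfadjoint f by exact: selfadjointM.
split; last by rewrite /r -!scalerAl !mulrDl !mul1r -/f fs fb addrC.
split; first by apply: selfadjointZ; apply: selfadjointD => //; exact: star1.
rewrite -[LHS](scaleVK _ n2) /r -/f; congr (_ *: _).
rewrite -scalerAl (scaleKV _ n2) -scalerAr.
have -> : (1 + f) * (1 + f) = (1 + f) + f * (1 + f) by nc_ring.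
rewrite mulrDr mulr1 ff -[RHS](scaleVK _ n2); congr (_ *: _); nc_ring.
Qed.

(** Take the projection for the positive axis of an invertible perturbation [b]
    of [t^2 - x^2]; it stands in for the spectral projection of [x] on
    [[-t, t]].  If it vanishes, then [x^2] is bounded below. *)
Lemma rr0_small_projection x t : real_rank_zero [set: A] -> selfadjoint x ->
  0 < t -> inv x \/ exists r, [/\ projection r, r <> 0 & cnorm (x * r) <= 2 * t].
Proof.
move=> rr sx t0; pose h := t ^+ 2 / 2.
have t20 : 0 < t ^+ 2 by rewrite exprn_gt0.
have h0 : 0 < h by rewrite divr_gt0.
have sxx : selfadjoint (x * x) by exact: selfadjointM.
have [|b [_ sb /inv_inT ib bx]] := rr ((t ^+ 2)%:C%:A - x * x) I _ h h0.
  by apply: selfadjointB => //; exact: selfadjoint_real.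
have [s [ps ss sc]] := pos_sqrt_comm (pos_sq sb).
have bs : b * s = s * b by apply: sc; rewrite mulrA.
have [s' [s1 s2]] : inv s by apply: (@inv_factor _ _ _ s); rewrite ss; exact: invM.
have ssa := pos_sa ps.
have [pr rb] := sign_projection sb ssa ss bs s1 s2.
set r := 2^-1%:C *: _ in pr rb.
pose d := (t ^+ 2)%:C%:A - x * x - b.
have sd : selfadjoint d.
  by do 2 apply: selfadjointB => //; exact: selfadjoint_real.
have dh : cnorm d <= h by exact: ltW.
have [r0|r0] := eqVneq r 0.
  left; have bsN : b = - s.
    have : r * s = 0 by rewrite r0 mul0r.
    rewrite /r -scalerAl mulrDl mul1r -mulrA s2 mulr1 => /(congr1 (fun y => (2 : R)%:C *: y)).
    by rewrite scaleKV ?pnatr_eq0// scaler0 addrC => /eqP; rewrite addr_eq0 => /eqP.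
  have : inv ((s + (h%:C%:A - d)) + h%:C%:A).
    by apply: pos_addr_inv => //; apply: posD => //; exact: ball_pos.
  have -> : s + (h%:C%:A - d) + h%:C%:A = x * x.
    have th : t ^+ 2 = h + h by rewrite /h -splitr.
    by rewrite /d bsN th; nc_ring.
  by move=> i; apply: (@inv_factor _ _ _ x).
right; exists r; split=> //; first exact/eqP.
have [sr rr'] := pr.
rewrite -(@ler_pXn2r _ 2) ?nnegrE ?cnorm_ge0 ?mulr_ge0 ?(ltW t0)//.
rewrite -cnorm_starM starM sx sr.
apply: (@le_trans _ _ (t ^+ 2 + h)); last by rewrite exprMn /h; lra.
apply: pos_norm_le.
  by rewrite -{1}sr -{1}sx -starM; exact: pos_starM.
have -> : (t ^+ 2 + h)%:C%:A - r * x * (x * r) =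
   (t ^+ 2)%:C *: (1 - r) + (r * b) * r + (h%:C%:A + r * d * r).
  rewrite /d (_ : r * (_ - b) * r = (t ^+ 2)%:C *: (r * r) - r * x * (x * r) - r * b * r).
    by rewrite rr'; nc_ring.
  nc_ring.
apply: posD; first apply: posD.
- by apply: posZ; [exact: ltW|apply: proj_pos; exact: projC].
- by rewrite rb -{1}sr; exact: pos_conj.
- apply: ball_posD; first by rewrite -{1}sr; exact: selfadjoint_conj.
  by rewrite (le_trans (cnorm_Mproj _ pr))// (le_trans (cnorm_projM _ pr)).
Qed.

(** Corners inherit real rank zero: the Schur complement of the other corner
    of an invertible perturbation of [x + r]. *)
Lemma rr0_corner x r (e : R) : real_rank_zero [set: A] -> projection r ->
  selfadjoint x -> x * r = 0 -> 0 < e ->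
  exists y y', [/\ selfadjoint y, selfadjoint y', y * y' = 1 - r,
    cnorm (x - y) < e & [/\ y * r = 0, r * y = 0, y' * r = 0 & r * y' = 0]].
Proof.
move=> rr pr sx xr e0; have [sr rr_] := pr.
have rx : r * x = 0 by have := congr1 star xr; rewrite starM sr sx star0.
pose h := Num.min (1 / 2) (e / 3).
have h0 : 0 < h by rewrite lt_min !divr_gt0.
have [h1 h2] : h <= 1 / 2 /\ h <= e / 3 by rewrite /h !ge_min !lexx orbT.
have [|b [_ sb /inv_inT[c [c1 c2]] bx]] := rr (x + r) I _ h h0.
  exact: selfadjointD.
pose p := 1 - r; have pp : projection p := projC pr; have [sp pp_] := pp.
have rp : r * p = 0 by rewrite /p mulrBr mulr1 rr_ subrr.
have pr0 : p * r = 0 by rewrite /p mulrBl mul1r rr_ subrr.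
have sc : selfadjoint c := inv_sa sb c1.
have rp1 : r + p = 1 by rewrite /p addrC subrK.
pose d := r * b * r + p.
have hd : cnorm (1 - d) <= h.
  have -> : 1 - d = r * (x + r - b) * r.
    have -> : r * (x + r - b) * r = (r * x) * r + (r * r) * r - r * b * r by nc_ring.
    by rewrite rx rr_ mul0r rr_ /d /p; nc_ring.
  rewrite (le_trans (cnorm_Mproj _ pr))// (le_trans (cnorm_projM _ pr))//.
  exact: ltW.
have [k [k1 k2]] : inv d by apply: inv_near1; rewrite (le_lt_trans hd)//; lra.
have sd : selfadjoint d.
  by apply: selfadjointD => //; rewrite -{1}sr; exact: selfadjoint_conj.
have sk : selfadjoint k := inv_sa sd k1.
have rd : r * d = d * r.
  have d1 : r * (r * b * r) = r * b * r by rewrite !mulrA rr_.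
  have d2 : r * b * r * r = r * b * r by rewrite -mulrA rr_.
  by rewrite /d mulrDr mulrDl rp pr0 d1 d2.
have rk : r * k = k * r by exact: inv_comm k1 k2 rd.
have krbr : k * (r * b * r) = r.
  have -> : r * b * r = d * r by rewrite /d mulrDl pr0 addr0 -[RHS]mulrA rr_.
  by rewrite mulrA k2 mul1r.
have nk : cnorm k <= 2.
  have : cnorm k <= 1 + h * cnorm k.
    have {1}-> : k = 1 + (1 - d) * k by rewrite mulrBl k1 mul1r addrC subrK.
    rewrite (le_trans (cnormD _ _))// cnorm1 lerD2l (le_trans (cnormM _ _))//.
    by rewrite ler_wpM2r ?cnorm_ge0.
  have := cnorm_ge0 k; nra.
pose z := p * b * r; pose z' := r * b * p.
have zs : star z = z' by rewrite /z /z' !starM sr sp sb mulrA.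
have nz : cnorm z <= h.
  have -> : z = p * (b - (x + r)) * r.
    have -> : p * (b - (x + r)) * r = z - p * (x * r) - p * (r * r) by rewrite /z; nc_ring.
    by rewrite xr rr_ pr0 mulr0 !subr0.
  rewrite (le_trans (cnorm_Mproj _ pr))// (le_trans (cnorm_projM _ pp))//.
  by rewrite cnormB_sym ltW.
exists (p * b * p - z * k * z'), (p * c * p).
have e1 : z * (r * c * p) + p * b * p * (p * c * p) = p.
  rewrite /z (_ : _ + _ = p * b * ((r * r) + p * p) * c * p); last by nc_ring.
  by rewrite rr_ pp_ rp1 mulr1 -(mulrA _ b c) c1 mulr1 pp_.
have e2 : r * b * r * (r * c * p) + z' * (p * c * p) = 0.
  rewrite /z' (_ : _ + _ = r * b * ((r * r) + p * p) * c * p); last by nc_ring.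
  by rewrite rr_ pp_ rp1 mulr1 -(mulrA _ b c) c1 mulr1.
split.
- apply: selfadjointB; first by rewrite -{1}sp; exact: selfadjoint_conj.
  by rewrite -{1}[z]starK zs; exact: selfadjoint_conj.
- by rewrite -{1}sp; exact: selfadjoint_conj.
- rewrite mulrBl -[z * k * z' * _]mulrA.
  have -> : z' * (p * c * p) = - (r * b * r * (r * c * p)).
    by apply/eqP; rewrite -addr_eq0 addrC e2.
  rewrite mulrN opprK -[z * k * _]mulrA (mulrA k) krbr.
  by rewrite (_ : r * (r * c * p) = r * c * p) 1?addrC ?e1// !mulrA rr_.
- have -> : x - (p * b * p - z * k * z') = p * (x + r - b) * p + z * k * z'.
    have -> : p * (x + r - b) * p = p * x * p + (p * r) * p - p * b * p by nc_ring.
    have -> : p * x * p = x.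
      by rewrite /p mulrBl mul1r rx subr0 mulrBr mulr1 xr subr0.
    by rewrite pr0 mul0r addr0; nc_ring.
  have n1 : cnorm (p * (x + r - b) * p) < h.
    by rewrite (le_lt_trans (cnorm_Mproj _ pp))// (le_lt_trans (cnorm_projM _ pp)).
  have n2 : cnorm (z * k * z') <= h.
    rewrite (le_trans (cnormM _ _))// -zs cnorm_star.
    have := cnormM z k; have := cnorm_ge0 z; have := cnorm_ge0 k.
    have := cnorm_ge0 (z * k); nra.
  by rewrite (le_lt_trans (cnormD _ _))//; lra.
- split.
  + rewrite (_ : _ * r = p * b * (p * r) - z * k * r * b * (p * r)).
      by rewrite pr0 !mulr0 subrr.
    rewrite /z'; nc_ring.
  + rewrite (_ : r * _ = (r * p) * b * p - (r * p) * b * r * k * z').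
      by rewrite rp !mul0r subrr.
    rewrite /z; nc_ring.
  + by rewrite -(mulrA _ p r) pr0 mulr0.
  + by rewrite !mulrA rp !mul0r.
Qed.

(** Over the decomposition [1 = g (1 - p) + c + p] the element below is the sum
    of the invertible corner [f] and of the block matrix
    [[X c, t star k], [t k, 0]], which is invertible for every [X] because [k]
    is an isometry from [c] into [p]; the last term fills the rest of [p]. *)
Lemma patch_inv (f f' X g p w : A) (t : R) (c := (1 - g) * (1 - p)) (k := w * c) :
  projection g -> projection p -> g * p = p * g ->
  selfadjoint f -> selfadjoint f' -> f * f' = g * (1 - p) ->
  g * f = f -> p * f = 0 -> g * f' = f' -> p * f' = 0 ->
  selfadjoint X -> X * p = 0 -> X * g = g * X ->
  star w * w = 1 - g -> p * w = w -> t != 0 ->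
  let Y := f + (X * c + t%:C *: (k + star k) + t%:C *: (p - k * star k)) in
  [/\ selfadjoint Y, inv Y & cnorm k <= 1].
Proof.
move=> pg pp gp sf sf' ff' gf pf gf' pf' sX Xp Xg ww pw t0 Y.
have [sp ppp] := pp; have [sg ggg] := pg.
have cgp : (1 - g) * (1 - p) = (1 - p) * (1 - g).
  by have -> : (1 - g) * (1 - p) = (1 - p) * (1 - g) + (g * p - p * g)
    by [nc_ring]; rewrite gp subrr addr0.
have pc : projection c by apply: projM => //; exact: projC.
have [sc ccc] := pc.
have fg : f * g = f by have := congr1 star gf; rewrite starM sf sg.
have fp : f * p = 0 by have := congr1 star pf; rewrite starM sf sp star0.
have f'g : f' * g = f' by have := congr1 star gf'; rewrite starM sf' sg.
have f'p : f' * p = 0 by have := congr1 star pf'; rewrite starM sf' sp star0.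
have pX : p * X = 0 by have := congr1 star Xp; rewrite starM sX sp star0.
have gc : g * c = 0 by rewrite /c mulrA (mulrBr g) mulr1 ggg subrr mul0r.
have cg : c * g = 0 by have := congr1 star gc; rewrite starM sc sg star0.
have cp : c * p = 0 by rewrite /c -mulrA (mulrBl p _ p) mul1r ppp subrr mulr0.
have pc0 : p * c = 0 by have := congr1 star cp; rewrite starM sc sp star0.
have Xc : X * c = c * X.
  have e1 : X * c = X - X * g by rewrite /c cgp mulrA (mulrBr X) mulr1 Xp subr0 mulrBr mulr1.
  have e2 : c * X = X - g * X by rewrite /c -mulrA [(1 - p) * X]mulrBl mul1r pX subr0 mulrBl mul1r.
  by rewrite e1 e2 Xg.
set l := star k in Y *.
have lE : l = c * star w by rewrite /l /k starM sc.
have pk : p * k = k by rewrite /k mulrA pw.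
have kc : k * c = k by rewrite /k -mulrA ccc.
have cl : c * l = l by rewrite lE mulrA ccc.
have lp : l * p = l by have := congr1 star pk; rewrite starM sp.
have ck : c * k = 0 by rewrite -pk mulrA cp mul0r.
have lc : l * c = 0 by have := congr1 star ck; rewrite starM sc star0.
have kp : k * p = 0 by rewrite -kc -mulrA cp mulr0.
have pl : p * l = 0 by have := congr1 star kp; rewrite starM sp star0.
have lk : l * k = c.
  rewrite lE /k mulrA -(mulrA c) ww.
  have -> : c * (1 - g) = c by rewrite mulrBr mulr1 cg subr0.
  exact: ccc.
have kk : k * k = 0 by rewrite -{1}kc -mulrA ck mulr0.
have ll : l * l = 0 by rewrite -{2}cl mulrA lc mul0r.
have skl : star k = l by [].
have sl : star l = k by rewrite /l starK.
have sXc : selfadjoint (X * c) by apply: selfadjointM.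
have sY : selfadjoint Y.
  apply: selfadjointD => //; apply: selfadjointD; first apply: selfadjointD => //.
    by apply: selfadjointZ; rewrite /selfadjoint starD skl sl addrC.
  apply: selfadjointZ; apply: selfadjointB => //.
  by rewrite /selfadjoint starM skl sl.
pose u := t^-1; have tu : t * u = 1 by rewrite divff.
pose M' := u%:C *: (k + l) - (u * u)%:C *: (k * X * l) + u%:C *: (p - k * l).
have sY' : selfadjoint (f' + M').
  apply: selfadjointD => //; apply: selfadjointD; first apply: selfadjointB => //.
  - by apply: selfadjointZ; rewrite /selfadjoint starD skl sl addrC.
  - by apply: selfadjointZ; rewrite /selfadjoint (starM _ l) (starM k) skl sl sX mulrA.
  - by apply: selfadjointZ; apply: selfadjointB => //; rewrite /selfadjoint starM skl sl.
have YY' : Y * (f' + M') = 1.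
  have fk : f * k = 0 by rewrite -pk mulrA fp mul0r.
  have fc : f * c = 0 by rewrite -{1}fg -mulrA gc mulr0.
  have fl : f * l = 0 by rewrite -cl mulrA fc mul0r.
  have kf' : k * f' = 0 by rewrite -kc -mulrA -gf' (mulrA c) cg mul0r mulr0.
  have lf' : l * f' = 0 by rewrite -lp -mulrA pf' mulr0.
  have cf' : c * f' = 0 by rewrite -gf' mulrA cg mul0r.
  have -> : Y * (f' + M') = f * f'
    + (u%:C *: (f * k + f * l) - (u * u)%:C *: ((f * k) * X * l)
       + u%:C *: (f * p - (f * k) * l))
    + (X * (c * f') + t%:C *: (k * f' + l * f') + t%:C *: (p * f' - k * (l * f')))
    + (u%:C *: (X * (c * k) + X * (c * l) + X * (c * p) - X * (c * k) * l)
       - (u * u)%:C *: (X * (c * k) * X * l))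
    + ((t * u)%:C *: (k * k + k * l + k * p - k * k * l + l * k + l * l + l * p
         - (l * k) * l + p * k + p * l + p * p - (p * k) * l
         - k * (l * k) - k * (l * l) - k * (l * p) + k * (l * k) * l)
       - (t * u * u)%:C *: ((k * k) * X * l + (l * k) * X * l + (p * k) * X * l
         - k * (l * k) * X * l)).
    by rewrite /Y /M'; nc_ring.
  rewrite ff' fk fl fp cf' kf' lf' pf' ck cl cp kk kp lk ll lp pk pl ppp kc cl tu.
  have -> : c * X * l = X * l by rewrite -Xc -mulrA cl.
  rewrite mul1r.
  have -> : g * (1 - p) = 1 - p - c by rewrite /c; nc_ring.
  nc_ring.
split=> //.
  exists (f' + M'); split=> //.
  by have := congr1 star YY'; rewrite starM sY sY' star1.
rewrite -(@ler_pXn2r _ 2) ?nnegrE ?cnorm_ge0 ?ler01// -cnorm_starM -/l lk expr1n.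
exact: proj_norm.
Qed.

End Projections.

(** * The index is a scalar; projections in the range *)

Section IndexScalar.
Context {R : realType} {A : cstarType R} {P : set A} (E : cond_exp P).
Hypothesis P1 : P 1.
Context (s : seq (A * A)).
Hypothesis qb : quasi_basis E s.

Lemma index_central x : x * (\sum_(w <- s) w.1 * w.2) = (\sum_(w <- s) w.1 * w.2) * x.
Proof.
rewrite mulr_suml mulr_sumr.
transitivity (\sum_(w' <- s) \sum_(w <- s) w.1 * E (w.2 * (x * w'.1)) * w'.2).
  by apply: eq_bigr => w' _; rewrite mulrA [x * w'.1 in LHS](qb _).1 mulr_suml.
rewrite exchange_big; apply: eq_bigr => w _ /=.
rewrite -mulrA [w.2 * x](qb _).2 mulr_sumr; apply: eq_bigr => w' _.
by rewrite !mulrA.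
Qed.

(** The index does not depend on the quasi-basis, and [star] reverses a
    quasi-basis into another one. *)
Lemma index_selfadjoint : selfadjoint (\sum_(w <- s) w.1 * w.2).
Proof.
have qb' : quasi_basis E [seq (star w.2, star w.1) | w <- s].
  move=> x; rewrite !big_map /=; split; first exact: qb_starE.
  rewrite -[LHS]starK {1}(qb (star x)).1 star_sum; apply: eq_bigr => w _.
  by rewrite starM -exp_star// starM starK.
rewrite /selfadjoint star_sum -(IndexE qb) (IndexE qb') big_map.
by apply: eq_bigr => w _; rewrite starM.
Qed.

End IndexScalar.

(** A central self-adjoint [c] has a spectral value [t], plus or minus its
    norm, and [c - t] generates a proper closed ideal. *)
Lemma simple_central_scalar (R : realType) (A : cstarType R) (c : A) :
  simple_cstar A -> selfadjoint c -> (forall x, x * c = c * x) ->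
  exists t : R, c = t%:C%:A.
Proof.
move=> simpA sc cc.
have [t nt] : exists t : R, ~ inv (c - t%:C%:A).
  apply: contrapT => /forallNP h; apply: (sa_norm_spectrum sc).
  have n1 : -1 != 0 :> R by rewrite oppr_eq0 oner_eq0.
  split; last first.
    have /contrapT := h (- cnorm c).
    by rewrite rmorphN scaleNr opprK addrC.
  apply/(invZ _ n1); have /contrapT := h (cnorm c).
  by rewrite (_ : c - _ = (-1)%:C *: ((cnorm c)%:C%:A - c))//; nc_ring.
exists t; apply/eqP; rewrite -subr_eq0; apply/eqP.
set d := c - t%:C%:A in nt *.
have dc x : x * d = d * x by rewrite /d mulrBr mulrBl cc -scalerAl -scalerAr mulr1 mul1r.
pose I : set A := [set y | forall e : R, 0 < e -> exists a, cnorm (y - d * a) < e].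
have idI : closed_ideal I.
  split.
  - by move=> e e0; exists 0; rewrite mulr0 subrr cnorm0.
  - move=> x y Ix Iy e e0; have e2 : 0 < e / 2 by rewrite divr_gt0.
    have [a ha] := Ix _ e2; have [b hb] := Iy _ e2.
    exists (a + b); rewrite mulrDr opprD addrACA (le_lt_trans (cnormD _ _))//.
    by rewrite [ltRHS]splitr ltrD.
  - move=> x y Iy e e0; have x1 : 0 < cnorm x + 1 by rewrite ltr_wpDl ?cnorm_ge0.
    have [|a] := Iy (e / (cnorm x + 1)); first by rewrite divr_gt0.
    rewrite ltr_pdivlMr// => ha; exists (x * a).
    rewrite mulrA -dc -mulrA -mulrBr (le_lt_trans (cnormM _ _))//.
    by rewrite (le_lt_trans _ ha)// mulrC ler_wpM2l ?cnorm_ge0// lerDl.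
  - move=> x y Ix e e0; have x1 : 0 < cnorm y + 1 by rewrite ltr_wpDl ?cnorm_ge0.
    have [|a] := Ix (e / (cnorm y + 1)); first by rewrite divr_gt0.
    rewrite ltr_pdivlMr// => ha; exists (a * y).
    rewrite mulrA -mulrBl (le_lt_trans (cnormM _ _))//.
    by rewrite (le_lt_trans _ ha)// ler_wpM2l ?cnorm_ge0// lerDl.
  - move=> x h e e0; have e2 : 0 < e / 2 by rewrite divr_gt0.
    have [y Iy xy] := h _ e2; have [a ha] := Iy _ e2.
    exists a; rewrite (le_lt_trans (cnormB_tri y _ _))// [ltRHS]splitr.
    exact: ltrD.
have Id : I d by move=> e e0; exists 1; rewrite mulr1 subrr cnorm0.
have [I0|IT] := simpA _ idI; first by move: Id; rewrite I0.
have [a ha] : exists a, cnorm (1 - d * a) < 1.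
  by have : I 1 by [rewrite IT]; move=> /(_ 1 ltr01).
case: nt; apply: (@inv_factor _ _ _ a); first exact: inv_near1.
by rewrite dc; exact: inv_near1.
Qed.

Section Range.
Context {R : realType} {A : cstarType R} {P : set A} (E : cond_exp P).
Hypothesis P1 : P 1.
Implicit Types (x y a b p : A) (X : Ainf A).

Lemma exp_fix_closed_alg : closed_alg [set x | E x = x].
Proof.
split => /=.
- exact: exp1.
- by move=> x y h1 h2; rewrite expD h1 h2.
- by move=> c x h; rewrite expZ h.
- by move=> x y; exact: exp_fixM.
- move=> x h; apply/eqP; rewrite -subr_eq0; apply/eqP/cnorm_eq0P => e e0.
  have [|y /= Ey xy] := h (e / 2); first by rewrite divr_gt0.
  have -> : E x - x = E (x - y) - (x - y) by rewrite expB Ey; nc_ring.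
  rewrite (le_trans (cnormD _ _))// cnormN.
  have := cexp_contractive E (x - y); lra.
Qed.

Lemma exp_fix_inv x y : E x = x -> x * y = 1 -> y * x = 1 -> E y = y.
Proof.
move=> Ex xy yx.
have e1 : x * E y = 1 by rewrite -{1}Ex -expMl// Ex xy exp1.
by rewrite -[LHS]mul1r -yx -mulrA e1 mulr1.
Qed.

(** Almost idempotent self-adjoint elements are near projections, found
    inside the range of [E] through the sign of [2 a - 1]. *)
Lemma exp_near_projection a : selfadjoint a -> E a = a ->
  4 * cnorm (a - a * a) < 1 ->
  exists p, [/\ projection p, E p = p & cnorm (p - a) <= 2 * cnorm (a - a * a)].
Proof.
move=> sa Ea ha.
pose b := (2 : R)%:C *: a - 1; pose x := (4 : R)%:C *: (a - a * a).
have sb : selfadjoint b by apply: selfadjointB; [exact: selfadjointZ|exact: star1].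
have sx : selfadjoint x.
  by apply: selfadjointZ; apply: selfadjointB => //; exact: selfadjointM.
have nx : cnorm x = 4 * cnorm (a - a * a) by rewrite /x cnorm_real ger0_norm.
have [|y [sy yx ey By]] := sqrt_1m sx; first by rewrite nx ltW.
have Eb : E b = b by rewrite /b expB expZ Ea exp1.
have Ey : E y = y.
  apply: (By _ exp_fix_closed_alg) => /=.
  by rewrite /x expZ expB Ea exp_fixM.
have by_ : b * y = y * b.
  by apply: (By _ (closed_alg_commutant b)) => /=; rewrite /b /x; nc_ring.
have bb : (1 - y) * (1 - y) = b * b by rewrite ey /b /x; nc_ring.
have [s' [s1 s2]] : inv (1 - y).
  by apply: inv_near1; rewrite subKr (le_lt_trans yx)// nx.
have ss : selfadjoint (1 - y) by apply: selfadjointB => //; exact: star1.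
have bs : b * (1 - y) = (1 - y) * b.
  have -> : b * (1 - y) = (1 - y) * b + (y * b - b * y) by nc_ring.
  by rewrite by_ subrr addr0.
have [pp pb] := sign_projection sb ss bb bs s1 s2.
set p := 2^-1%:C *: _ in pp pb; exists p.
have Es' : E s' = s' by apply: (exp_fix_inv _ s1 s2); rewrite expB exp1// Ey.
split=> //; first by rewrite /p expZ expD exp1// exp_fixM.
have n2 : 2 != 0 :> R by rewrite pnatr_eq0.
have -> : p - a = 2^-1%:C *: (((2 : R)%:C *: p - 1) * y).
  have pb' : ((2 : R)%:C *: p - 1) * b = 1 - y.
    have : (2 : R)%:C *: p = 1 + b * s' by rewrite /p scaleKV.
    move=> ->; rewrite addrAC subrr add0r.
    have bs' : b * s' = s' * b by exact: inv_comm s1 s2 bs.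
    by rewrite bs' -mulrA -bb mulrA s2 mul1r.
  have pb2 : ((2 : R)%:C *: p - 1) * (1 - y) = b.
    have : (2 : R)%:C *: p = 1 + b * s' by rewrite /p scaleKV.
    by move=> ->; rewrite addrAC subrr add0r -mulrA s2 mulr1.
  have -> : ((2 : R)%:C *: p - 1) * y = (2 : R)%:C *: p - 1 - b.
    by rewrite -[in RHS]pb2; nc_ring.
  by rewrite /b -[LHS](scaleVK _ n2); congr (_ *: _); nc_ring.
rewrite cnorm_real gtr0_norm ?invr_gt0// mulrC ler_pdivrMr//.
have : cnorm ((2 : R)%:C *: p - 1) <= 1.
  have : cnorm ((2 : R)%:C *: p - 1) ^+ 2 = 1.
    rewrite -cnorm_sqr; last by apply: selfadjointB; [apply: selfadjointZ; case: pp|exact: star1].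
    rewrite (_ : _ * _ = (4 : R)%:C *: (p * p - p) + 1); last by nc_ring.
    by rewrite pp.2 subrr scaler0 add0r cnorm1.
  have := cnorm_ge0 ((2 : R)%:C *: p - 1); nra.
have := cnormM ((2 : R)%:C *: p - 1) y; have := cnorm_ge0 y.
have := cnorm_ge0 ((2 : R)%:C *: p - 1); nra.
Qed.

End Range.

(** * Permanence of real rank zero *)

Section Permanence.
Context {R : realType} {A : cstarType R} {P : set A} (E : cond_exp P).
Hypothesis P1 : P 1.
Context (s : seq (A * A)).
Hypothesis qb : quasi_basis E s.
Context (lam : R).
Hypothesis index_lam : \sum_(w <- s) w.1 * w.2 = lam%:C%:A.
Hypothesis rokE : tracial_rokhlin E.
Hypothesis rrA : real_rank_zero [set: A].
Implicit Types (x y p r : A).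

Let F := Einf_exp E P1.
Let F1 : @Pinf R A P 1 := Pinf1 P1.
Let sF := [seq (const_inf w.1, const_inf w.2) | w <- s].
Let qbF : quasi_basis F sF := Einf_quasi_basis P1 qb.
Let indexF : \sum_(w <- sF) w.1 * w.2 = lam%:C%:A.
Proof.
rewrite big_map -const1 -constZ -index_lam const_sum.
by apply: eq_bigr => w _; rewrite constM.
Qed.

(** For a projection [z], the hereditary subalgebra generated by [z] lies in the
    corner cut by [z], so the partial isometry may be taken with range
    under [z]. *)
Lemma rokhlin_projection (z : Ainf A) : projection z -> z <> 0 ->
  exists e v : Ainf A, let g := lam%:C *: F e in
    [/\ projection e, forall x, const_inf x * e = e * const_inf x,
        projection g, star v * v = 1 - g /\ z * v = v
      & injective (fun x : A => const_inf x * e)].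
Proof.
move=> pz z0; have [e [pe ec [pg [q [pq hq [v [vv vv']]]]] inj]] :=
  rokE (pos_positive (proj_pos pz)) z0.
have gE : const_inf (Index E) * Einf E e = lam%:C *: F e.
  by rewrite (IndexE qb) index_lam constZ const1 -scalerAl mul1r.
exists e, v; rewrite gE in pg vv *; split=> //; split=> //.
have zq := hereditary_generated_proj pz hq.
have vq : v = q * v.
  by rewrite -vv' -mulrA vv (pisometry (projC pg) vv).
by rewrite vq mulrA zq.
Qed.

Lemma const_rok_neq0 (e : Ainf A) (x : A) :
  injective (fun x : A => const_inf x * e) -> x <> 0 -> const_inf x * e <> 0.
Proof.
by move=> inj x0 h; apply: x0; apply: inj; rewrite /= h const0 mul0r.
Qed.

Lemma base_rokhlin : exists e : Ainf A, let g := lam%:C *: F e in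
    [/\ projection e, forall x, const_inf x * e = e * const_inf x,
        projection g, 0 < lam & injective (fun x : A => const_inf x * e)].
Proof.
have p1 : projection (1 : Ainf A) by split; [exact: star1|rewrite mulr1].
have n1 : (1 : Ainf A) <> 0 by apply/eqP; rewrite oner_eq0.
have [e [v [pe ec pg _ inj]]] := rokhlin_projection p1 n1.
exists e; split=> //; apply: (index_gt0 F1 qbF indexF pe pg).
have /eqP/(const_rok_neq0 inj) := oner_neq0 A.
by rewrite const1 mul1r.
Qed.

(** Either [x] is invertible or it almost kills a nonzero projection of [P]:
    such a projection exists in [A], and [phi] carries it into [P] up to a
    small error. *)
Lemma small_projection x (t : R) : E x = x -> selfadjoint x -> 0 < t ->
  inv x \/ exists p, [/\ projection p, p <> 0, E p = p & cnorm (x * p) <= t].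
Proof.
move=> Ex sx t0.
have [e [pe ec pg l0 inj]] := base_rokhlin.
have t40 : 0 < t / (4 * lam) by rewrite divr_gt0// mulr_gt0.
have [ix|[r [pr r0 xr]]] := rr0_small_projection rrA sx t40; first by left.
right.
pose X := phi F lam e (const_inf r).
have [sr rr] := pr.
have EX : Einf E X = X := phi_exp F lam e _.
have pX : projection X.
  split; first by rewrite /selfadjoint /X (phi_star F F1 lam pe (ec r)) -const_star sr.
  by rewrite /X (phiM F1 qbF indexF pe pg) -?constM ?rr.
have X0 : X <> 0.
  move=> X0; apply: (const_rok_neq0 inj r0).
  by apply: (phi_eq0 F1 qbF indexF pe (ec r)); rewrite -const_star sr -constM rr.
have xX : cnorm (const_inf x * X) <= t / 2.
  have -> : const_inf x * X = phi F lam e (const_inf (x * r)).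
    rewrite /X /phi -scalerAr; congr (_ *: _).
    have Fx : F (const_inf x) = const_inf x by rewrite Einf_expE Einf_const Ex.
    by rewrite -{1}Fx -expMl// Fx mulrA ec constM mulrA.
  rewrite (le_trans (phi_norm F lam pe _))// gtr0_norm//.
  rewrite (le_trans (ler_wpM2l (ltW l0) (const_norm _)))//.
  rewrite (le_trans (ler_wpM2l (ltW l0) xr))//.
  rewrite (_ : lam * _ = t / 2)//; field.
  by rewrite gt_eqF.
have [u [uX su Eu]] := Pinf_repr P1 pX.1 EX.
(* [1/8] keeps the projection found near an entry from vanishing; the other
   bound controls its product with [x]. *)
pose h := Num.min (1 / 8) (t / (8 * (cnorm x + 1))).
have x1 : 0 < cnorm x + 1 by rewrite ltr_wpDl ?cnorm_ge0.
have h0 : 0 < h by rewrite lt_min !divr_gt0// mulr_gt0.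
have h1 : h <= 1 / 8 by rewrite /h ge_min lexx.
have h2 : h * (8 * (cnorm x + 1)) <= t.
  by rewrite -ler_pdivlMr ?mulr_gt0// /h ge_min lexx orbT.
have k1 : \forall n \near \oo, cnorm (u n - u n * u n) < h.
  by apply: (@cls_norm_near _ _ (u - u * u)); rewrite raddfB /= cls_mul uX pX.2 subrr cnorm0.
have k2 : \forall n \near \oo, cnorm (x * u n) < 3 / 4 * t.
  apply: (@cls_norm_near _ _ (Linf (cst_linf_subproof x) * u)).
  by rewrite cls_mul uX (le_lt_trans xX)//; lra.
(* Entries of norm at most [1/2] from some index on would bound the norm of the
   nonzero projection [X] by [1/2]. *)
have [n [un1 un2 un3]] : exists n, [/\ cnorm (u n - u n * u n) < h,
    cnorm (x * u n) < 3 / 4 * t & 1 / 2 < cnorm (u n)].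
  apply: contrapT => /forallNP hn.
  have nX : cnorm X <= 1 / 2.
    rewrite -uX; apply: (Ainf_norm_le _ _).2 => e' e'0.
    near=> n; have := hn n; rewrite leNgt => hn'; apply/negP => un3; apply: hn'.
    split; [by near: n|by near: n|].
    by rewrite (le_lt_trans _ un3)// lerDl ltW.
  apply: X0; apply: cnorm0_eq0.
  have := cnorm_starM X; rewrite pX.1 pX.2; have := cnorm_ge0 X; nra.
have [|p [pp Ep pu]] := exp_near_projection P1 (su n) (Eu n); first lra.
exists p; split=> //.
  move=> p0; move: pu; rewrite p0 sub0r cnormN; lra.
rewrite -[p](subrK (u n)) mulrDr (le_trans (cnormD _ _))//.
have := cnormM x (p - u n); have := cnorm_ge0 x; have := cnorm_ge0 (p - u n).
nra.
Unshelve. all: by end_near. Qed.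

Lemma permanence x (eps : R) : P x -> selfadjoint x -> 0 < eps ->
  exists y, [/\ P y, selfadjoint y, invertible_in P y & cnorm (x - y) < eps].
Proof.
move=> Px sx eps0; have Ex : E x = x by exact: cexp_id.
have e80 : 0 < eps / 8 by rewrite divr_gt0.
have [ix|[p [pp p0 Ep xp]]] := small_projection Ex sx e80.
  exists x; split=> //; last by rewrite subrr cnorm0.
  exact: (exp_inv P1 Ex).
have [sp ppp] := pp.
pose x0 := (1 - p) * x * (1 - p).
have [sp1 pp1] := projC pp.
have sx0 : selfadjoint x0 by rewrite /x0 -{1}sp1; exact: selfadjoint_conj.
have p1p : (1 - p) * p = 0 by rewrite mulrBl mul1r ppp subrr.
have x0p : x0 * p = 0 by rewrite /x0 -mulrA p1p mulr0.
have Ex0 : E x0 = x0.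
  have E1p : E (1 - p) = 1 - p by rewrite expB exp1// Ep.
  by rewrite /x0 exp_fixM// exp_fixM.
have xx0 : cnorm (x - x0) <= eps / 4.
  have -> : x - x0 = p * x + (1 - p) * (x * p) by rewrite /x0; nc_ring.
  rewrite (le_trans (cnormD _ _))//.
  have := cnorm_projM (x * p) (projC pp).
  have : cnorm (p * x) = cnorm (x * p) by rewrite -cnorm_star starM sp sx.
  lra.
(* [1 - g] for the second projection [e] is controlled by [e1], not by [e]. *)
have [e1 [pe1 ec1 pg1 l0 inj1]] := base_rokhlin.
have [se1 ee1] := pe1.
have ppc := const_projection pp.
have pz : projection (const_inf p * e1) by apply: projM.
have [e [v [pe ec pg [vv zv] _]]] := rokhlin_projection pz (const_rok_neq0 inj1 p0).
set g := lam%:C *: F e in pg vv.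
have Fp : F (const_inf p) = const_inf p by rewrite Einf_expE Einf_const Ep.
have Fx0 : F (const_inf x0) = const_inf x0 by rewrite Einf_expE Einf_const Ex0.
have e1v : e1 * v = v.
  by rewrite -zv !mulrA -ec1 -(mulrA _ e1 e1) ee1.
have pv : const_inf p * v = v by rewrite -zv !mulrA ppc.2.
pose w := (Num.sqrt lam)%:C *: F v.
have ww : star w * w = 1 - g.
  rewrite (rokhlin_transfer F1 qbF indexF pe1 pg1 l0 e1v) vv expB exp1//.
  by rewrite /g expZ expK.
have pw : const_inf p * w = w by rewrite /w -scalerAr -{1}Fp -expMl// Fp pv.
have Fw : F w = w by rewrite /w expZ expK.
have Fg : F g = g by rewrite /g expZ expK.
have m0 : 0 < eps / (4 * lam) by rewrite divr_gt0// mulr_gt0.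
have [y [y' [sy sy' yy' x0y [yp py y'p py']]]] := rr0_corner rrA pp sx0 x0p m0.
pose ph x := phi F lam e (const_inf x).
have phM a b : ph a * ph b = ph (a * b).
  by rewrite /ph (phiM F1 qbF indexF pe pg)// constM.
have phsa a : selfadjoint a -> selfadjoint (ph a).
  by move=> sa; rewrite /selfadjoint /ph (phi_star F F1 lam pe (ec a)) -const_star sa.
have phfix a : E a = a -> ph a = g * const_inf a.
  by move=> Ea; rewrite /ph phi_fix// Einf_expE Einf_const Ea.
have phE a : F (ph a) = ph a by exact: phi_exp.
have php a : p * a = 0 -> const_inf p * ph a = 0.
  move=> pa; rewrite /ph /phi -scalerAr -{1}Fp -expMl// Fp mulrA ec -mulrA.
  by rewrite -constM pa const0 mulr0 linear0 scaler0.
have gph a : g * ph a = ph a.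
  have -> : g = ph 1 by rewrite phfix ?const1 ?mulr1// exp1.
  by rewrite phM mul1r.
have gp : g * const_inf p = const_inf p * g by rewrite (rokhlin_commute F1 lam (ec p) Fp).
have gx : const_inf x0 * g = g * const_inf x0 by rewrite (rokhlin_commute F1 lam (ec x0) Fx0).
have f1 : ph y * ph y' = g * (1 - const_inf p).
  by rewrite phM yy' phfix ?constB ?const1// expB exp1// Ep.
pose d := eps / 32; have d0 : 0 < d by rewrite divr_gt0.
have [] := patch_inv pg ppc gp (phsa _ sy) (phsa _ sy') f1
  (gph _) (php _ py) (gph _) (php _ py') _ _ gx ww pw (lt0r_neq0 d0).
- by rewrite /selfadjoint -const_star sx0.
- by rewrite -constM x0p const0.
set c := (1 - g) * _; set k := w * c => sY iY nk; set Y := (_ + _) in sY iY.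
have FY : Einf E Y = Y.
  have Fc : F c = c.
    by apply: exp_fixM => //; rewrite expB exp1// ?Fg ?Fp.
  have Fk : F k = k by exact: exp_fixM.
  have Fk' : F (star k) = star k by rewrite exp_star// Fk.
  rewrite -Einf_expE -/F /Y expD phE !expD !expZ expB expD Fk Fk' Fp.
  by rewrite (exp_fixM F1 Fx0 Fc) (exp_fixM F1 Fk Fk').
have nY : cnorm (const_inf x - Y) < eps.
  have -> : const_inf x - Y = const_inf (x - x0) + ph (x0 - y)
     - (d%:C *: (k + star k) + d%:C *: (const_inf p - k * star k)).
    have e2 : ph (x0 - y) = g * const_inf x0 - ph y.
      by rewrite /ph constB phiB -/(ph x0) phfix.
    have e3 : const_inf x0 * c = const_inf x0 - g * const_inf x0.
      have -> : const_inf x0 * c = const_inf x0 - const_inf x0 * g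
         - const_inf x0 * const_inf p + const_inf x0 * (g * const_inf p).
        by rewrite /c; nc_ring.
      by rewrite gp mulrA -constM x0p const0 mul0r subr0 addr0 gx.
    by rewrite /Y e2 e3 constB; nc_ring.
  have n1 : cnorm (const_inf (x - x0)) <= eps / 4 by rewrite (le_trans (const_norm _)).
  have n2 : cnorm (ph (x0 - y)) <= eps / 4.
    rewrite (le_trans (phi_norm F lam pe _))// gtr0_norm//.
    rewrite (le_trans (ler_wpM2l (ltW l0) (const_norm _)))//.
    rewrite (le_trans (ler_wpM2l (ltW l0) (ltW x0y)))//.
    rewrite (_ : lam * _ = eps / 4)//; field.
    by rewrite gt_eqF.
  have n3 : cnorm (d%:C *: (k + star k)) <= 2 * d.
    rewrite cnorm_real gtr0_norm// mulrC ler_pM2r// (le_trans (cnormD _ _))//.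
    by rewrite cnorm_star; lra.
  have n4 : cnorm (d%:C *: (const_inf p - k * star k)) <= 2 * d.
    rewrite cnorm_real gtr0_norm// mulrC ler_pM2r// (le_trans (cnormD _ _))// cnormN.
    have := proj_norm ppc; have := cnormM k (star k); rewrite cnorm_star.
    have := cnorm_ge0 k; nra.
  have n5 := cnormD (d%:C *: (k + star k)) (d%:C *: (const_inf p - k * star k)).
  have n6 := cnormD (const_inf (x - x0)) (ph (x0 - y)).
  apply: (le_lt_trans (cnormD _ _)); rewrite cnormN.
  have d32 : d * 32 = eps by rewrite /d divfK// pnatr_eq0.
  lra.
exact: (Pinf_lift P1 sY iY FY nY).
Qed.

End Permanence.

Theorem proposition4p9 (R : realType) (A : cstarType R) (P : set A)
    (E : cond_exp P) :
  unital_cstar_subalgebra P ->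
  index_finite E ->
  tracial_rokhlin E ->
  simple_cstar A ->
  real_rank_zero [set: A] ->
  real_rank_zero P.
Proof.
move=> [_ P1] [s qb] rokE simpA rrA x Px sx e e0.
have [lam index_lam] := simple_central_scalar simpA
  (index_selfadjoint P1 qb) (index_central qb).
exact: (permanence P1 qb index_lam rokE rrA Px sx e0).
Qed.
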